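(* Consider the Benjamin-Bona-Mahony equation $\Delta_1 := u_t+u_x+uu_x-u_{xxt}=0$ for $u=u(x,t)$. The non-classical symmetries of this equation in the case $\eta=1$, that is, the non-classical symmetries of the form $X=\xi(x,t,u)\,\partial_x+\partial_t+\varphi(x,t,u)\,\partial_u$, are spanned by $$\sigma_1=u_x+u_t,\qquad \sigma_2=u_x,\qquad \sigma_3=u_t .$$ Here each such $X$ is identified with the expression $u_t+\xi u_x-\varphi$, and the assertion is that the real linear span of all these expressions equals the real linear span of $\sigma_1,\sigma_2,\sigma_3$.
   Context: Let $X=\xi(x,t,u)\,\partial_x+\eta(x,t,u)\,\partial_t+\varphi(x,t,u)\,\partial_u$ be a vector field whose coefficients are smooth functions of $(x,t,u)$. Its invariant surface condition is $\Delta_2:=\eta u_t+\xi u_x-\varphi=0$. Put $Q=\varphi-\xi u_x-\eta u_t$. The fourth prolongation of $X$ is $X^{(4)}=X+\sum_J\varphi^J\partial_{u_J}$, where $J$ runs over the multi-indices in $x,t$ of orders $1$ to $4$, $\varphi^J=D_JQ+\xi u_{Jx}+\eta u_{Jt}$, and $D_J$ is the iterated total derivative. The field $X$ is a non-classical symmetry of $\Delta_1=0$ if $X^{(4)}\Delta_1=0$ holds whenever $\Delta_1=0$ and $\Delta_2=0$ hold together with their differential consequences. Without loss of generality one normalizes $\eta=1$ or $\eta=0$; the claim concerns $\eta=1$, where the invariant surface condition reads $u_t=\varphi-\xi u_x$.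
   Formalization: The differential consequences of Δ₁=0 and Δ₂=0 are only those of order at most 3 (Δ₁ itself; D_JΔ₂ with |J|≤2); imposing all of them would make every X, e.g. ∂_t+u∂_u, a non-classical symmetry. Coefficients are smooth on all of R³. *)

(* Defs.v *)
(* Stdlib reals with Coquelicot. *)
From Stdlib Require Import Reals List Arith.
From Coquelicot Require Import Coquelicot.
Open Scope R_scope.

(** * Smooth functions of (x,t,u) *)

Definition dx (f : R -> R -> R -> R) : R -> R -> R -> R :=
  fun x t u => Derive (fun s => f s t u) x.
Definition dt (f : R -> R -> R -> R) : R -> R -> R -> R :=
  fun x t u => Derive (fun s => f x s u) t.
Definition du (f : R -> R -> R -> R) : R -> R -> R -> R :=
  fun x t u => Derive (fun s => f x t s) u.

Fixpoint C_k (k : nat) (f : R -> R -> R -> R) : Prop :=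
  (forall p : R * R * R,
     continuous (fun q : R * R * R => f (fst (fst q)) (snd (fst q)) (snd q)) p) /\
  match k with
  | O => True
  | S k' =>
      (forall x t u, ex_derive (fun s => f s t u) x /\
                     ex_derive (fun s => f x s u) t /\
                     ex_derive (fun s => f x t s) u) /\
      C_k k' (dx f) /\ C_k k' (dt f) /\ C_k k' (du f)
  end.

Definition smooth (f : R -> R -> R -> R) : Prop := forall k, C_k k f.

(** * Jet space *)

(* A point of the infinite jet space: [jd z i j] is the coordinate u_J for the
   multi-index J consisting of i letters x and j letters t (so [jd z 0 0] is u).
   All functions considered below depend on finitely many coordinates. *)
Record jet : Type := mkjet { jx : R; jt : R; jd : nat -> nat -> R }.

Definition dfun : Type := jet -> R.

Definition coord (i j : nat) : dfun := fun z => jd z i j.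

Definition lift (f : R -> R -> R -> R) : dfun :=
  fun z => f (jx z) (jt z) (jd z 0%nat 0%nat).

Definition set_jd (z : jet) (i j : nat) (s : R) : jet :=
  mkjet (jx z) (jt z)
    (fun a b => if (Nat.eqb a i && Nat.eqb b j)%bool then s else jd z a b).

Definition pd_x (F : dfun) : dfun :=
  fun z => Derive (fun s => F (mkjet s (jt z) (jd z))) (jx z).
Definition pd_t (F : dfun) : dfun :=
  fun z => Derive (fun s => F (mkjet (jx z) s (jd z))) (jt z).
Definition pd (i j : nat) (F : dfun) : dfun :=
  fun z => Derive (fun s => F (set_jd z i j s)) (jd z i j).

(* Sum of [a i j] over the multi-indices with m <= i + j <= n. *)
Definition sum_order (m n : nat) (a : nat -> nat -> R) : R :=
  sum_n_m (fun k => sum_n (fun i => a i (k - i)%nat) k) m n.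

(* Total derivatives, on functions of order at most 4. *)
Definition total_x (F : dfun) : dfun :=
  fun z => pd_x F z + sum_order 0 4 (fun i j => jd z (S i) j * pd i j F z).
Definition total_t (F : dfun) : dfun :=
  fun z => pd_t F z + sum_order 0 4 (fun i j => jd z i (S j) * pd i j F z).

(* D_J; the order of F plus |J| must not exceed 5. *)
Definition DJ (i j : nat) (F : dfun) : dfun :=
  Nat.iter i total_x (Nat.iter j total_t F).

(** * Prolongation of xi d_x + eta d_t + phi d_u *)

Definition charQ (xi eta phi : R -> R -> R -> R) : dfun :=
  fun z => lift phi z - lift xi z * coord 1 0 z - lift eta z * coord 0 1 z.

Definition phiJ (xi eta phi : R -> R -> R -> R) (i j : nat) : dfun :=
  fun z => DJ i j (charQ xi eta phi) z
           + lift xi z * coord (S i) j z + lift eta z * coord i (S j) z.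

Definition prolong4 (xi eta phi : R -> R -> R -> R) (F : dfun) : dfun :=
  fun z => lift xi z * pd_x F z + lift eta z * pd_t F z + lift phi z * pd 0 0 F z
           + sum_order 1 4 (fun i j => phiJ xi eta phi i j z * pd i j F z).

(** * Non-classical symmetries of the Benjamin-Bona-Mahony equation *)

Definition Delta1 : dfun :=
  fun z => coord 0 1 z + coord 1 0 z + coord 0 0 z * coord 1 0 z - coord 2 1 z.

Definition Delta2 (xi eta phi : R -> R -> R -> R) : dfun :=
  fun z => lift eta z * coord 0 1 z + lift xi z * coord 1 0 z - lift phi z.

(* F, a function of order k, vanishes at z together with its differential
   consequences D_J F of order at most n. *)
Definition vanishes_upto (n k : nat) (F : dfun) (z : jet) : Prop :=
  forall i j : nat, (i + j + k <= n)%nat -> DJ i j F z = 0.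

(* Delta1 has order 3 and Delta2 order 1; the differential consequences are
   those on the jet space of order 3, the order of the equation.  The
   restriction matters: identically,
     X^(4) Delta1 = xi D_x Delta1 + eta D_t Delta1 - D_t Delta2
                    - (1+u) D_x Delta2 + D_xxt Delta2 - u_x Delta2,
   so imposing also the fourth-order consequences D_x Delta1, D_t Delta1 and
   D_xxt Delta2 would make every vector field satisfy the condition. *)
Definition nonclassical_symmetry (xi eta phi : R -> R -> R -> R) : Prop :=
  forall z : jet,
    vanishes_upto 3 3 Delta1 z ->
    vanishes_upto 3 1 (Delta2 xi eta phi) z ->
    prolong4 xi eta phi Delta1 z = 0.

(** * Real linear spans of sets of differential functions *)

Definition lin_comb (l : list (R * dfun)) : dfun :=
  fun z => fold_right (fun p acc => fst p * snd p z + acc) 0 l.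

Definition in_span (S : dfun -> Prop) (F : dfun) : Prop :=
  exists l : list (R * dfun),
    (forall p, In p l -> S (snd p)) /\ (forall z, F z = lin_comb l z).

(* The expressions u_t + xi u_x - phi attached to the non-classical symmetries
   with eta = 1. *)
Definition nonclassical_expr (E : dfun) : Prop :=
  exists xi phi : R -> R -> R -> R,
    smooth xi /\ smooth phi /\
    nonclassical_symmetry xi (fun _ _ _ => 1) phi /\
    (forall z, E z = coord 0 1 z + lift xi z * coord 1 0 z - lift phi z).

Definition sigma1 : dfun := fun z => coord 1 0 z + coord 0 1 z.
Definition sigma2 : dfun := coord 1 0.
Definition sigma3 : dfun := coord 0 1.

(* Main.v *)
Require Import Defs.
From Stdlib Require Import Reals List Lra Lia FunctionalExtensionality Classical.
From Coquelicot Require Import Coquelicot.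
Open Scope R_scope.

(** Write p, q, r for u_x, u_xx, u_xxx.  On the jets satisfying u_t = phi - xi p and
    its consequences, the symmetry condition becomes a polynomial identity in p, q, r
    on the hypersurface Delta1 = 0.

    Where xi <> 0, Delta1 = 0 can be solved for r.  The coefficients of q^2 and p q
    give xi_u = 0 and phi = a u + b, and the remaining ones, with their derivatives,
    give xi_x = 0, b = a, xi_t = a xi and a_t = a^2.  Since (xi^2)_t = 2 a xi^2 also
    holds where xi = 0, xi vanishes nowhere or everywhere.  In the first case
    a_t = a^2 holds on the whole line, which forces a = 0: global smoothness is what
    excludes the scaling symmetry (t + c) d_t - (u + 1) d_u, which has a = -1/(t + c).

    If xi = 0, put g = phi_u.  Where g <> 0, Delta1 = 0 can be solved for q, and
    eliminating all the other unknowns yields g_u = 0 and g_t = g^2, so again g = 0.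
    Then phi depends on (x,t) only, and Delta1 = 0, now linear in p, leaves phi = 0. *)

(** * Calculus of smooth functions *)

Lemma fun3_ext (f g : R -> R -> R -> R) :
  (forall x t u, f x t u = g x t u) -> f = g.
Proof.
  intros H; extensionality x; extensionality t; extensionality u; apply H.
Qed.

Lemma C_k_S (k : nat) : forall f, C_k (S k) f -> C_k k f.
Proof.
  induction k as [|k IH]; intros f [Hc [He [Hx [Ht Hu]]]].
  - split; auto.
  - split; [assumption|]. split; [assumption|]. auto.
Qed.

Lemma smooth_dx f : smooth f -> smooth (dx f).
Proof. intros H k; destruct (H (S k)) as [_ [_ [? [_ _]]]]; assumption. Qed.
Lemma smooth_dt f : smooth f -> smooth (dt f).
Proof. intros H k; destruct (H (S k)) as [_ [_ [_ [? _]]]]; assumption. Qed.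
Lemma smooth_du f : smooth f -> smooth (du f).
Proof. intros H k; destruct (H (S k)) as [_ [_ [_ [_ ?]]]]; assumption. Qed.

Lemma is_derive_dx f x t u :
  smooth f -> is_derive (fun s => f s t u) x (dx f x t u).
Proof.
  intros H; destruct (H 1%nat) as [_ [He _]]. apply Derive_correct, (He x t u).
Qed.
Lemma is_derive_dt f x t u :
  smooth f -> is_derive (fun s => f x s u) t (dt f x t u).
Proof.
  intros H; destruct (H 1%nat) as [_ [He _]]. apply Derive_correct, (He x t u).
Qed.
Lemma is_derive_du f x t u :
  smooth f -> is_derive (fun s => f x t s) u (du f x t u).
Proof.
  intros H; destruct (H 1%nat) as [_ [He _]]. apply Derive_correct, (He x t u).
Qed.

Lemma dx_const c : dx (fun _ _ _ => c) = fun _ _ _ => 0.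
Proof. apply fun3_ext; intros; unfold dx; apply Derive_const. Qed.
Lemma dt_const c : dt (fun _ _ _ => c) = fun _ _ _ => 0.
Proof. apply fun3_ext; intros; unfold dt; apply Derive_const. Qed.
Lemma du_const c : du (fun _ _ _ => c) = fun _ _ _ => 0.
Proof. apply fun3_ext; intros; unfold du; apply Derive_const. Qed.

Lemma C_k_const (c : R) (k : nat) : C_k k (fun _ _ _ => c).
Proof.
  revert c; induction k as [|k IH]; intros c.
  - split; [intros p; apply continuous_const | exact I].
  - split; [intros p; apply continuous_const |].
    split; [intros x t u; repeat split; apply ex_derive_const |].
    repeat split.
    + rewrite dx_const; apply IH.
    + rewrite dt_const; apply IH.
    + rewrite du_const; apply IH.
Qed.

Lemma smooth_const (c : R) : smooth (fun _ _ _ => c).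
Proof. intros k; apply C_k_const. Qed.

Lemma C_k_plus (k : nat) : forall f g, C_k k f -> C_k k g ->
  C_k k (fun x t u => f x t u + g x t u).
Proof.
  induction k as [|k IH]; intros f g Hf Hg.
  - split; [|exact I]. intros p.
    apply (continuous_plus _ _ p (proj1 Hf p) (proj1 Hg p)).
  - destruct Hf as [cf [ef [xf [tf uf]]]], Hg as [cg [eg [xg [tg ug]]]].
    split; [intros p; apply (continuous_plus _ _ p (cf p) (cg p))|].
    split.
    + intros x t u; destruct (ef x t u) as [? [? ?]], (eg x t u) as [? [? ?]].
      repeat split; apply (ex_derive_plus (V := R_NormedModule)); assumption.
    + repeat split.
      * replace (dx _) with (fun x t u => dx f x t u + dx g x t u); [now apply IH|].
        apply fun3_ext; intros x t u; unfold dx, dt, du; symmetry; apply Derive_plus;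
          [apply (ef x t u)|apply (eg x t u)].
      * replace (dt _) with (fun x t u => dt f x t u + dt g x t u); [now apply IH|].
        apply fun3_ext; intros x t u; unfold dx, dt, du; symmetry; apply Derive_plus;
          [apply (ef x t u)|apply (eg x t u)].
      * replace (du _) with (fun x t u => du f x t u + du g x t u); [now apply IH|].
        apply fun3_ext; intros x t u; unfold dx, dt, du; symmetry; apply Derive_plus;
          [apply (ef x t u)|apply (eg x t u)].
Qed.

Lemma C_k_mult (k : nat) : forall f g, C_k k f -> C_k k g ->
  C_k k (fun x t u => f x t u * g x t u).
Proof.
  induction k as [|k IH]; intros f g Hf Hg.
  - split; [|exact I]. intros p.
    apply (continuous_mult _ _ p (proj1 Hf p) (proj1 Hg p)).
  - pose proof (C_k_S k f Hf) as Hf'. pose proof (C_k_S k g Hg) as Hg'.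
    destruct Hf as [cf [ef [xf [tf uf]]]], Hg as [cg [eg [xg [tg ug]]]].
    split; [intros p; apply (continuous_mult _ _ p (cf p) (cg p))|].
    split.
    + intros x t u; destruct (ef x t u) as [? [? ?]], (eg x t u) as [? [? ?]].
      repeat split.
      * now apply (ex_derive_mult (fun s => f s t u) (fun s => g s t u)).
      * now apply (ex_derive_mult (fun s => f x s u) (fun s => g x s u)).
      * now apply (ex_derive_mult (fun s => f x t s) (fun s => g x t s)).
    + repeat split.
      * replace (dx _) with (fun x t u => dx f x t u * g x t u + f x t u * dx g x t u);
          [now apply C_k_plus; apply IH|].
        apply fun3_ext; intros x t u; unfold dx, dt, du; symmetry;
          apply (Derive_mult (fun s => f s t u) (fun s => g s t u));
          [apply (ef x t u)|apply (eg x t u)].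
      * replace (dt _) with (fun x t u => dt f x t u * g x t u + f x t u * dt g x t u);
          [now apply C_k_plus; apply IH|].
        apply fun3_ext; intros x t u; unfold dx, dt, du; symmetry;
          apply (Derive_mult (fun s => f x s u) (fun s => g x s u));
          [apply (ef x t u)|apply (eg x t u)].
      * replace (du _) with (fun x t u => du f x t u * g x t u + f x t u * du g x t u);
          [now apply C_k_plus; apply IH|].
        apply fun3_ext; intros x t u; unfold dx, dt, du; symmetry;
          apply (Derive_mult (fun s => f x t s) (fun s => g x t s));
          [apply (ef x t u)|apply (eg x t u)].
Qed.

Lemma smooth_plus f g : smooth f -> smooth g ->
  smooth (fun x t u => f x t u + g x t u).
Proof. intros Hf Hg k; now apply C_k_plus. Qed.
Lemma smooth_mult f g : smooth f -> smooth g ->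
  smooth (fun x t u => f x t u * g x t u).
Proof. intros Hf Hg k; now apply C_k_mult. Qed.

Lemma smooth_continuous f : smooth f ->
  forall p : R * R * R,
    continuous (fun q : R * R * R => f (fst (fst q)) (snd (fst q)) (snd q)) p.
Proof. intros H; apply (H 0%nat). Qed.

Ltac smooth :=
  lazymatch goal with
  | |- smooth (dx _) => apply smooth_dx; smooth
  | |- smooth (dt _) => apply smooth_dt; smooth
  | |- smooth (du _) => apply smooth_du; smooth
  | |- smooth (fun x t u => @?f x t u + @?g x t u) => apply (smooth_plus f g); smooth
  | |- smooth (fun x t u => @?f x t u * @?g x t u) => apply (smooth_mult f g); smooth
  | |- smooth (fun x t u => ?f x t u) => change (smooth f); smooth
  | |- smooth (fun _ _ _ => ?c) => first [assumption | apply smooth_const]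
  | |- smooth _ => assumption
  end.

(** Schwarz's theorem asks for mixed derivatives continuous in two variables with the third frozen;
    this restricts joint continuity to such slices. *)
Lemma smooth_comp_continuous f (a b c : R * R -> R) (p : R * R) : smooth f ->
  continuous a p -> continuous b p -> continuous c p ->
  continuous (fun q => f (a q) (b q) (c q)) p.
Proof.
  intros H Ha Hb Hc.
  apply (continuous_comp_2 (fun q => (a q, b q)) c (fun ab w => f (fst ab) (snd ab) w)).
  - apply (continuous_comp_2 a b (fun v w => (v, w))); [assumption..|].
    intros P [e He]; exists e; intros y [Y1 Y2]; apply He; now split.
  - assumption.
  - exact (smooth_continuous f H (a p, b p, c p)).
Qed.

(** Schwarz's theorem. Read from left to right, this rule and the next two move [dx] outwards and
    [du] inwards, giving mixed derivatives the normal form [dx (dt (du f))]. *)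
Lemma du_dx f : smooth f -> du (dx f) = dx (du f).
Proof.
  intros H; apply fun3_ext; intros x t u. unfold du, dx.
  symmetry; apply (Schwarz (fun a b => f a t b) x u).
  - apply locally_2d_locally, filter_forall; intros [a b].
    repeat split; eexists.
    + now apply (is_derive_dx f).
    + now apply (is_derive_du f).
    + now apply (is_derive_dx (du f)), smooth_du.
    + now apply (is_derive_du (dx f)), smooth_dx.
  - apply continuity_2d_pt_filterlim.
    apply (smooth_comp_continuous (dx (du f))); [smooth|..];
      first [apply continuous_fst | apply continuous_snd | apply continuous_const].
  - apply continuity_2d_pt_filterlim.
    apply (smooth_comp_continuous (du (dx f))); [smooth|..];
      first [apply continuous_fst | apply continuous_snd | apply continuous_const].
Qed.

Lemma du_dt f : smooth f -> du (dt f) = dt (du f).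
Proof.
  intros H; apply fun3_ext; intros x t u. unfold du, dt.
  symmetry; apply (Schwarz (fun a b => f x a b) t u).
  - apply locally_2d_locally, filter_forall; intros [a b].
    repeat split; eexists.
    + now apply (is_derive_dt f).
    + now apply (is_derive_du f).
    + now apply (is_derive_dt (du f)), smooth_du.
    + now apply (is_derive_du (dt f)), smooth_dt.
  - apply continuity_2d_pt_filterlim.
    apply (smooth_comp_continuous (dt (du f))); [smooth|..];
      first [apply continuous_fst | apply continuous_snd | apply continuous_const].
  - apply continuity_2d_pt_filterlim.
    apply (smooth_comp_continuous (du (dt f))); [smooth|..];
      first [apply continuous_fst | apply continuous_snd | apply continuous_const].
Qed.

Lemma dt_dx f : smooth f -> dt (dx f) = dx (dt f).
Proof.
  intros H; apply fun3_ext; intros x t u. unfold dx, dt.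
  symmetry; apply (Schwarz (fun a b => f a b u) x t).
  - apply locally_2d_locally, filter_forall; intros [a b].
    repeat split; eexists.
    + now apply (is_derive_dx f).
    + now apply (is_derive_dt f).
    + now apply (is_derive_dx (dt f)), smooth_dt.
    + now apply (is_derive_dt (dx f)), smooth_dx.
  - apply continuity_2d_pt_filterlim.
    apply (smooth_comp_continuous (dx (dt f))); [smooth|..];
      first [apply continuous_fst | apply continuous_snd | apply continuous_const].
  - apply continuity_2d_pt_filterlim.
    apply (smooth_comp_continuous (dt (dx f))); [smooth|..];
      first [apply continuous_fst | apply continuous_snd | apply continuous_const].
Qed.

Ltac commute H :=
  repeat first [rewrite du_dx in H by smooth | rewrite du_dt in H by smooth
               | rewrite dt_dx in H by smooth].

(** * Total derivatives and the symmetry condition on jets *)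

Lemma set_jd_id z i j : set_jd z i j (jd z i j) = z.
Proof.
  destruct z as [x t d]; unfold set_jd; simpl; f_equal.
  extensionality a; extensionality b.
  destruct (Nat.eqb_spec a i), (Nat.eqb_spec b j); simpl; now subst.
Qed.

Lemma jet_eta z : mkjet (jx z) (jt z) (jd z) = z.
Proof. now destruct z. Qed.

(** [Derive] is total, so the sum and product rules need the existence of every partial derivative
    as a side condition. *)
Definition jet_diff (F : dfun) : Prop := forall z,
  ex_derive (fun s => F (mkjet s (jt z) (jd z))) (jx z) /\
  ex_derive (fun s => F (mkjet (jx z) s (jd z))) (jt z) /\
  forall i j, ex_derive (fun s => F (set_jd z i j s)) (jd z i j).

Lemma sum_order_ext m n a b : (forall i j, a i j = b i j) ->
  sum_order m n a = sum_order m n b.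
Proof.
  intros H; apply sum_n_m_ext; intros k; apply sum_n_ext; intros i; apply H.
Qed.

Lemma sum_order_plus m n a b :
  sum_order m n (fun i j => a i j + b i j) = sum_order m n a + sum_order m n b.
Proof.
  unfold sum_order.
  etransitivity; [|apply (sum_n_m_plus (G := R_AbelianMonoid))].
  apply sum_n_m_ext; intros k.
  apply (sum_n_plus (G := R_AbelianMonoid)).
Qed.

Lemma sum_order_scal m n c a :
  sum_order m n (fun i j => c * a i j) = c * sum_order m n a.
Proof.
  unfold sum_order.
  etransitivity; [|apply (sum_n_m_mult_l (K := R_Ring))].
  apply sum_n_m_ext; intros k.
  apply (sum_n_mult_l (K := R_Ring)).
Qed.

Lemma total_plus F G : jet_diff F -> jet_diff G ->
  jet_diff (fun z => F z + G z) /\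
  (forall z, total_x (fun z => F z + G z) z = total_x F z + total_x G z) /\
  (forall z, total_t (fun z => F z + G z) z = total_t F z + total_t G z).
Proof.
  intros HF HG; split; [|split].
  - intros z; destruct (HF z) as [? [? ?]], (HG z) as [? [? ?]].
    split; [|split; [|intros i j]];
      apply (ex_derive_plus (V := R_NormedModule)); auto.
  - intros z; destruct (HF z) as [? [? H]], (HG z) as [? [? H']].
    unfold total_x, pd_x. rewrite Derive_plus by assumption.
    rewrite (sum_order_ext _ _ _ (fun i j =>
      jd z (S i) j * pd i j F z + jd z (S i) j * pd i j G z)).
    + rewrite sum_order_plus; ring.
    + intros i j; unfold pd. rewrite Derive_plus by auto. ring.
  - intros z; destruct (HF z) as [? [? H]], (HG z) as [? [? H']].
    unfold total_t, pd_t. rewrite Derive_plus by assumption.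
    rewrite (sum_order_ext _ _ _ (fun i j =>
      jd z i (S j) * pd i j F z + jd z i (S j) * pd i j G z)).
    + rewrite sum_order_plus; ring.
    + intros i j; unfold pd. rewrite Derive_plus by auto. ring.
Qed.

Lemma total_mult F G : jet_diff F -> jet_diff G ->
  jet_diff (fun z => F z * G z) /\
  (forall z, total_x (fun z => F z * G z) z = total_x F z * G z + F z * total_x G z) /\
  (forall z, total_t (fun z => F z * G z) z = total_t F z * G z + F z * total_t G z).
Proof.
  intros HF HG; split; [|split].
  - intros z; destruct (HF z) as [? [? ?]], (HG z) as [? [? ?]].
    split; [|split; [|intros i j]].
    + now apply (ex_derive_mult (fun s => F (mkjet s (jt z) (jd z)))
        (fun s => G (mkjet s (jt z) (jd z)))).
    + now apply (ex_derive_mult (fun s => F (mkjet (jx z) s (jd z)))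
        (fun s => G (mkjet (jx z) s (jd z)))).
    + now apply (ex_derive_mult (fun s => F (set_jd z i j s))
        (fun s => G (set_jd z i j s))).
  - intros z; destruct (HF z) as [? [? H]], (HG z) as [? [? H']].
    unfold total_x, pd_x. rewrite Derive_mult, jet_eta by assumption.
    rewrite (sum_order_ext _ _ _ (fun i j =>
      G z * (jd z (S i) j * pd i j F z) + F z * (jd z (S i) j * pd i j G z))).
    + rewrite sum_order_plus, !sum_order_scal; ring.
    + intros i j; unfold pd. rewrite Derive_mult, set_jd_id by auto. ring.
  - intros z; destruct (HF z) as [? [? H]], (HG z) as [? [? H']].
    unfold total_t, pd_t. rewrite Derive_mult, jet_eta by assumption.
    rewrite (sum_order_ext _ _ _ (fun i j =>
      G z * (jd z i (S j) * pd i j F z) + F z * (jd z i (S j) * pd i j G z))).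
    + rewrite sum_order_plus, !sum_order_scal; ring.
    + intros i j; unfold pd. rewrite Derive_mult, set_jd_id by auto. ring.
Qed.

Ltac expand_sum_order :=
  unfold sum_order, sum_n, sum_n_m, Iter.iter_nat, Iter.iter; simpl;
  unfold plus, zero; simpl.

Lemma pd_coord a b i j z :
  pd a b (coord i j) z = if (Nat.eqb i a && Nat.eqb j b)%bool then 1 else 0.
Proof.
  unfold pd, coord; simpl.
  destruct (_ && _)%bool; [apply Derive_id | apply Derive_const].
Qed.

Lemma jet_diff_coord i j : jet_diff (coord i j).
Proof.
  intros z; split; [|split; [|intros a b]]; unfold coord; simpl.
  - apply ex_derive_const.
  - apply ex_derive_const.
  - destruct (_ && _)%bool; [apply ex_derive_id | apply ex_derive_const].
Qed.

(** The bound comes from the truncated sum in [total_x], which sends coordinates of order above 4 to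
    0. *)
Lemma total_x_coord i j z : (i + j <= 4)%nat ->
  total_x (coord i j) z = coord (S i) j z.
Proof.
  intros H; unfold total_x, pd_x. unfold coord at 1; simpl jd.
  rewrite Derive_const.
  rewrite (sum_order_ext _ _ _ (fun a b => jd z (S a) b *
     (if (Nat.eqb i a && Nat.eqb j b)%bool then 1 else 0))).
  2: now intros a b; rewrite pd_coord.
  do 5 (destruct i as [|i]; [do 5 (destruct j as [|j];
    [first [exfalso; lia | expand_sum_order; unfold coord; ring]|]);
    exfalso; lia|]); exfalso; lia.
Qed.

Lemma total_t_coord i j z : (i + j <= 4)%nat ->
  total_t (coord i j) z = coord i (S j) z.
Proof.
  intros H; unfold total_t, pd_t. unfold coord at 1; simpl jd.
  rewrite Derive_const.
  rewrite (sum_order_ext _ _ _ (fun a b => jd z a (S b) *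
     (if (Nat.eqb i a && Nat.eqb j b)%bool then 1 else 0))).
  2: now intros a b; rewrite pd_coord.
  do 5 (destruct i as [|i]; [do 5 (destruct j as [|j];
    [first [exfalso; lia | expand_sum_order; unfold coord; ring]|]);
    exfalso; lia|]); exfalso; lia.
Qed.

Lemma pd_lift f a b z :
  pd a b (lift f) z =
    if (Nat.eqb 0 a && Nat.eqb 0 b)%bool then lift (du f) z else 0.
Proof.
  unfold pd, lift; simpl jx; simpl jt; simpl jd.
  destruct a, b; simpl; try apply Derive_const; reflexivity.
Qed.

Lemma jet_diff_lift f : smooth f -> jet_diff (lift f).
Proof.
  intros H z; unfold lift; split; [|split; [|intros a b]]; simpl.
  - eexists; now apply is_derive_dx.
  - eexists; now apply is_derive_dt.
  - destruct a, b; simpl; try apply ex_derive_const.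
    eexists; now apply is_derive_du.
Qed.

Lemma total_x_lift f z :
  total_x (lift f) z = lift (dx f) z + coord 1 0 z * lift (du f) z.
Proof.
  unfold total_x.
  rewrite (sum_order_ext _ _ _ (fun a b => jd z (S a) b *
     (if (Nat.eqb 0 a && Nat.eqb 0 b)%bool then lift (du f) z else 0))).
  2: now intros a b; rewrite pd_lift.
  expand_sum_order. unfold pd_x, lift, dx, coord. simpl. ring.
Qed.

Lemma total_t_lift f z :
  total_t (lift f) z = lift (dt f) z + coord 0 1 z * lift (du f) z.
Proof.
  unfold total_t.
  rewrite (sum_order_ext _ _ _ (fun a b => jd z a (S b) *
     (if (Nat.eqb 0 a && Nat.eqb 0 b)%bool then lift (du f) z else 0))).
  2: now intros a b; rewrite pd_lift.
  expand_sum_order. unfold pd_t, lift, dt, coord. simpl. ring.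
Qed.

(** Differentiability travels with the value so that the rules compose by unification: [total_step]
    builds the derivative in an existential variable, and [total] compares it with the stated form
    by [ring]. *)
Definition has_total_x (F G : dfun) : Prop :=
  jet_diff F /\ forall z, total_x F z = G z.
Definition has_total_t (F G : dfun) : Prop :=
  jet_diff F /\ forall z, total_t F z = G z.

Lemma has_total_x_plus F F' G G' : has_total_x F F' -> has_total_x G G' ->
  has_total_x (fun z => F z + G z) (fun z => F' z + G' z).
Proof.
  intros [HF EF] [HG EG]; destruct (total_plus F G HF HG) as [H [E _]].
  split; [exact H|]; intros z; now rewrite E, EF, EG.
Qed.
Lemma has_total_t_plus F F' G G' : has_total_t F F' -> has_total_t G G' ->
  has_total_t (fun z => F z + G z) (fun z => F' z + G' z).
Proof.
  intros [HF EF] [HG EG]; destruct (total_plus F G HF HG) as [H [_ E]].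
  split; [exact H|]; intros z; now rewrite E, EF, EG.
Qed.
Lemma has_total_x_mult F F' G G' : has_total_x F F' -> has_total_x G G' ->
  has_total_x (fun z => F z * G z) (fun z => F' z * G z + F z * G' z).
Proof.
  intros [HF EF] [HG EG]; destruct (total_mult F G HF HG) as [H [E _]].
  split; [exact H|]; intros z; now rewrite E, EF, EG.
Qed.
Lemma has_total_t_mult F F' G G' : has_total_t F F' -> has_total_t G G' ->
  has_total_t (fun z => F z * G z) (fun z => F' z * G z + F z * G' z).
Proof.
  intros [HF EF] [HG EG]; destruct (total_mult F G HF HG) as [H [_ E]].
  split; [exact H|]; intros z; now rewrite E, EF, EG.
Qed.
Lemma has_total_x_coord i j : (i + j <= 4)%nat ->
  has_total_x (coord i j) (coord (S i) j).
Proof.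
  intros H; split; [apply jet_diff_coord | intros z; now apply total_x_coord].
Qed.
Lemma has_total_t_coord i j : (i + j <= 4)%nat ->
  has_total_t (coord i j) (coord i (S j)).
Proof.
  intros H; split; [apply jet_diff_coord | intros z; now apply total_t_coord].
Qed.
Lemma has_total_x_lift f : smooth f ->
  has_total_x (lift f) (fun z => lift (dx f) z + coord 1 0 z * lift (du f) z).
Proof.
  intros H; split; [now apply jet_diff_lift | apply total_x_lift].
Qed.
Lemma has_total_t_lift f : smooth f ->
  has_total_t (lift f) (fun z => lift (dt f) z + coord 0 1 z * lift (du f) z).
Proof.
  intros H; split; [now apply jet_diff_lift | apply total_t_lift].
Qed.
Lemma jet_diff_const c : jet_diff (fun _ => c).
Proof.
  intros z; split; [|split; [|intros a b]]; apply ex_derive_const.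
Qed.
Lemma has_total_x_const c : has_total_x (fun _ => c) (fun _ => 0).
Proof.
  split; [apply jet_diff_const|]; intros z; unfold total_x, pd_x.
  rewrite Derive_const.
  rewrite (sum_order_ext _ _ _ (fun i j => 0 * 0)).
  - rewrite sum_order_scal; ring.
  - intros i j; unfold pd; rewrite Derive_const; ring.
Qed.
Lemma has_total_t_const c : has_total_t (fun _ => c) (fun _ => 0).
Proof.
  split; [apply jet_diff_const|]; intros z; unfold total_t, pd_t.
  rewrite Derive_const.
  rewrite (sum_order_ext _ _ _ (fun i j => 0 * 0)).
  - rewrite sum_order_scal; ring.
  - intros i j; unfold pd; rewrite Derive_const; ring.
Qed.

(** [lift_x f] and [lift_xx f] are the first and second total x-derivatives of [lift f]. *)
Definition lift_x f : dfun := fun z => lift (dx f) z + coord 1 0 z * lift (du f) z.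
Definition lift_xx f : dfun := fun z =>
  lift (dx (dx f)) z + 2 * coord 1 0 z * lift (dx (du f)) z
  + coord 1 0 z * coord 1 0 z * lift (du (du f)) z + coord 2 0 z * lift (du f) z.

Ltac total_step :=
  lazymatch goal with
  | |- has_total_x (fun z => @?F z + @?G z) _ => eapply (has_total_x_plus F _ G)
  | |- has_total_t (fun z => @?F z + @?G z) _ => eapply (has_total_t_plus F _ G)
  | |- has_total_x (fun z => @?F z * @?G z) _ => eapply (has_total_x_mult F _ G)
  | |- has_total_t (fun z => @?F z * @?G z) _ => eapply (has_total_t_mult F _ G)
  | |- has_total_x (fun z => lift ?f z) _ => apply (has_total_x_lift f); smooth
  | |- has_total_t (fun z => lift ?f z) _ => apply (has_total_t_lift f); smooth
  | |- has_total_x (fun z => coord ?i ?j z) _ => apply (has_total_x_coord i j); simpl; lia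
  | |- has_total_t (fun z => coord ?i ?j z) _ => apply (has_total_t_coord i j); simpl; lia
  | |- has_total_x (fun _ => ?c) _ => apply (has_total_x_const c)
  | |- has_total_t (fun _ => ?c) _ => apply (has_total_t_const c)
  end.

Lemma has_total_x_eq F G H : has_total_x F G -> (forall z, G z = H z) -> total_x F = H.
Proof. intros [_ E] E'; extensionality z; now rewrite E, E'. Qed.
Lemma has_total_t_eq F G H : has_total_t F G -> (forall z, G z = H z) -> total_t F = H.
Proof. intros [_ E] E'; extensionality z; now rewrite E, E'. Qed.

Ltac total :=
  first [eapply has_total_x_eq | eapply has_total_t_eq];
  [repeat total_step
  | intros z; cbv beta; unfold lift_x, lift_xx;
    repeat first [rewrite du_dx by smooth | rewrite du_dt by smooth | rewrite dt_dx by smooth];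
    ring].

(** * Total derivatives of the invariant surface condition *)

Section Consequences.
Variables xi phi : R -> R -> R -> R.
Hypothesis Hxi : smooth xi.
Hypothesis Hphi : smooth phi.

(** [Delta2] at eta = 1, written like its derivatives below with sums and products alone, the
    operations that [total_step] handles; hence [(-1) *] for a minus sign. *)
Definition surface : dfun :=
  fun z => coord 0 1 z + (lift xi z * coord 1 0 z + (-1) * lift phi z).

Definition surface_x : dfun := fun z =>
  coord 1 1 z + (lift xi z * coord 2 0 z +
    (lift (dx xi) z + coord 1 0 z * lift (du xi) z) * coord 1 0 z
  + (-1) * (lift (dx phi) z + coord 1 0 z * lift (du phi) z)).

Definition surface_t : dfun := fun z =>
  coord 0 2 z + (lift xi z * coord 1 1 z
  + (lift (dt xi) z + coord 0 1 z * lift (du xi) z) * coord 1 0 z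
  + (-1) * (lift (dt phi) z + coord 0 1 z * lift (du phi) z)).

Definition surface_tx : dfun := fun z =>
  coord 1 2 z +
  ((lift (dx xi) z + coord 1 0 z * lift (du xi) z) * coord 1 1 z + lift xi z * coord 2 1 z
  + (lift (dx (dt xi)) z + coord 1 0 z * lift (dt (du xi)) z + coord 1 1 z * lift (du xi) z
     + coord 0 1 z * (lift (dx (du xi)) z + coord 1 0 z * lift (du (du xi)) z)) * coord 1 0 z
  + (lift (dt xi) z + coord 0 1 z * lift (du xi) z) * coord 2 0 z
  + (-1) * (lift (dx (dt phi)) z + coord 1 0 z * lift (dt (du phi)) z
     + coord 1 1 z * lift (du phi) z
     + coord 0 1 z * (lift (dx (du phi)) z + coord 1 0 z * lift (du (du phi)) z))).

Lemma total_x_surface : total_x surface = surface_x.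
Proof. unfold surface, surface_x. total. Qed.

Lemma total_t_surface : total_t surface = surface_t.
Proof. unfold surface, surface_t. total. Qed.

Lemma total_x_surface_t : total_x surface_t = surface_tx.
Proof. unfold surface_t, surface_tx. total. Qed.

Lemma total_x_surface_x : total_x surface_x = fun z =>
  coord 2 1 z + (lift xi z * coord 3 0 z + 2 * lift_x xi z * coord 2 0 z
  + lift_xx xi z * coord 1 0 z - lift_xx phi z).
Proof. unfold surface_x. total. Qed.

Lemma total_t_surface_t : total_t surface_t = fun z =>
  coord 0 3 z + (lift xi z * coord 1 2 z
  + 2 * (lift (dt xi) z + coord 0 1 z * lift (du xi) z) * coord 1 1 z
  + (lift (dt (dt xi)) z + 2 * coord 0 1 z * lift (dt (du xi)) z
     + coord 0 1 z * coord 0 1 z * lift (du (du xi)) z + coord 0 2 z * lift (du xi) z)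
    * coord 1 0 z
  - (lift (dt (dt phi)) z + 2 * coord 0 1 z * lift (dt (du phi)) z
     + coord 0 1 z * coord 0 1 z * lift (du (du phi)) z + coord 0 2 z * lift (du phi) z)).
Proof. unfold surface_t. total. Qed.

(** This is D_xxt of the surface condition, the only total derivative of it of order four that
    enters the prolongation. *)
Lemma total_x_surface_tx : total_x surface_tx = fun z =>
  coord 2 2 z + (lift xi z * coord 3 1 z + 2 * lift_x xi z * coord 2 1 z
  + lift_xx xi z * coord 1 1 z
  + (lift_xx (dt xi) z + coord 2 1 z * lift (du xi) z + 2 * coord 1 1 z * lift_x (du xi) z
     + coord 0 1 z * lift_xx (du xi) z) * coord 1 0 z
  + 2 * (lift_x (dt xi) z + coord 1 1 z * lift (du xi) z + coord 0 1 z * lift_x (du xi) z)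
      * coord 2 0 z
  + (lift (dt xi) z + coord 0 1 z * lift (du xi) z) * coord 3 0 z
  - (lift_xx (dt phi) z + coord 2 1 z * lift (du phi) z + 2 * coord 1 1 z * lift_x (du phi) z
     + coord 0 1 z * lift_xx (du phi) z)).
Proof. unfold surface_tx. total. Qed.

End Consequences.

(* Values of [lift_x f] and [lift_xx f] at a jet with u_x = p and u_xx = q. *)
Definition Ex (f : R -> R -> R -> R) x t u p := dx f x t u + p * du f x t u.
Definition Exx (f : R -> R -> R -> R) x t u p q :=
  dx (dx f) x t u + 2 * p * dx (du f) x t u + p * p * du (du f) x t u + q * du f x t u.

(** * The prolonged field applied to the equation *)

Lemma Delta2_surface xi phi :
  Delta2 xi (fun _ _ _ => 1) phi = surface xi phi.
Proof. extensionality z; unfold Delta2, surface, lift; ring. Qed.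

Lemma charQ_surface xi phi :
  charQ xi (fun _ _ _ => 1) phi = fun z => (-1) * surface xi phi z.
Proof. extensionality z; unfold charQ, surface, lift; ring. Qed.

Lemma total_scal_x c F : total_x (fun z => c * F z) = fun z => c * total_x F z.
Proof.
  extensionality z; unfold total_x, pd_x. rewrite Derive_scal.
  rewrite (sum_order_ext _ _ _ (fun i j => c * (jd z (S i) j * pd i j F z))).
  - rewrite sum_order_scal; ring.
  - intros i j; unfold pd; rewrite Derive_scal; ring.
Qed.
Lemma total_scal_t c F : total_t (fun z => c * F z) = fun z => c * total_t F z.
Proof.
  extensionality z; unfold total_t, pd_t. rewrite Derive_scal.
  rewrite (sum_order_ext _ _ _ (fun i j => c * (jd z i (S j) * pd i j F z))).
  - rewrite sum_order_scal; ring.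
  - intros i j; unfold pd; rewrite Derive_scal; ring.
Qed.

Lemma pd_Delta1 i j z : pd i j Delta1 z =
  match i, j with
  | 0%nat, 0%nat => coord 1 0 z | 1%nat, 0%nat => 1 + coord 0 0 z
  | 0%nat, 1%nat => 1 | 2%nat, 1%nat => -1 | _, _ => 0 end.
Proof.
  unfold pd, Delta1, coord.
  destruct i as [|[|[|i]]], j as [|[|j]]; simpl;
  (apply is_derive_unique; auto_derive; [exact I | ring]).
Qed.

Lemma prolong4_Delta1 xi phi z :
  prolong4 xi (fun _ _ _ => 1) phi Delta1 z =
    lift phi z * coord 1 0 z
    + (1 + coord 0 0 z) * phiJ xi (fun _ _ _ => 1) phi 1 0 z
    + phiJ xi (fun _ _ _ => 1) phi 0 1 z - phiJ xi (fun _ _ _ => 1) phi 2 1 z.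
Proof.
  unfold prolong4.
  assert (E : pd_x Delta1 z = 0) by (unfold pd_x, Delta1, coord; simpl; apply Derive_const).
  assert (E' : pd_t Delta1 z = 0) by (unfold pd_t, Delta1, coord; simpl; apply Derive_const).
  rewrite E, E'.
  rewrite (sum_order_ext _ _ _ (fun i j => phiJ xi (fun _ _ _ => 1) phi i j z *
   match i, j with
  | 0%nat, 0%nat => coord 1 0 z | 1%nat, 0%nat => 1 + coord 0 0 z
  | 0%nat, 1%nat => 1 | 2%nat, 1%nat => -1 | _, _ => 0 end)).
  2: now intros i j; rewrite pd_Delta1.
  rewrite pd_Delta1. expand_sum_order. ring.
Qed.

(** The characteristic Q is minus the surface condition, so D_J Q drops out wherever the consequence
    D_J of that condition is imposed. *)
Lemma phiJ_surface xi phi i j z :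
  phiJ xi (fun _ _ _ => 1) phi i j z =
    lift xi z * coord (S i) j z + coord i (S j) z - DJ i j (surface xi phi) z.
Proof.
  unfold phiJ. rewrite charQ_surface.
  assert (E : DJ i j (fun z => (-1) * surface xi phi z) = fun z => (-1) * DJ i j (surface xi phi) z).
  { unfold DJ. induction i as [|i IH]; simpl.
    - induction j as [|j IH]; simpl; [reflexivity|]. now rewrite IH, total_scal_t.
    - now rewrite IH, total_scal_x. }
  rewrite E. unfold lift at 2. ring.
Qed.

(* p, q, r, w, wx, wxx stand for u_x, u_xx, u_xxx, u_t, u_xt, u_xxt. *)
Lemma symmetry_condition xi phi (x t u p q r w wx wxx : R) :
  smooth xi -> smooth phi ->
  nonclassical_symmetry xi (fun _ _ _ => 1) phi ->
  w = phi x t u - xi x t u * p ->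
  wx = Ex phi x t u p - Ex xi x t u p * p - xi x t u * q ->
  wxx = Exx phi x t u p q - Exx xi x t u p q * p - 2 * Ex xi x t u p * q - xi x t u * r ->
  w + (1 + u) * p = wxx ->
  phi x t u * p + (1 + u) * (xi x t u * q + wx) + xi x t u * wx
  + (dt phi x t u + w * du phi x t u - (dt xi x t u + w * du xi x t u) * p - xi x t u * wx)
  - (Exx (dt phi) x t u p q + wxx * du phi x t u + 2 * wx * Ex (du phi) x t u p
     + w * Exx (du phi) x t u p q
     - (Exx (dt xi) x t u p q + wxx * du xi x t u + 2 * wx * Ex (du xi) x t u p
        + w * Exx (du xi) x t u p q) * p
     - 2 * (Ex (dt xi) x t u p + wx * du xi x t u + w * Ex (du xi) x t u p) * q
     - (dt xi x t u + w * du xi x t u) * r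
     - Exx xi x t u p q * wx - 2 * Ex xi x t u p * wxx) = 0.
Proof.
  intros Hxi Hphi Hs Hw Hwx Hwxx HD.
  (* A jet with the given coordinates is completed by solving the D_t, D_xt and D_tt consequences
     for u_tt, u_xtt and u_ttt in turn. Each unknown enters with coefficient 1, so its value is
     minus the consequence evaluated with that unknown set to 0. Coordinates of order 4 are 0; they
     cancel in phi^xxt. *)
  set (wt := dt phi x t u + w * du phi x t u
             - (dt xi x t u + w * du xi x t u) * p - xi x t u * wx).
  set (wtx := - (total_x (surface_t xi phi) (mkjet x t (fun i j =>
     match i, j with
     | 0%nat, 0%nat => u | 1%nat, 0%nat => p | 2%nat, 0%nat => q | 3%nat, 0%nat => r
     | 0%nat, 1%nat => w | 1%nat, 1%nat => wx | 2%nat, 1%nat => wxx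
     | 0%nat, 2%nat => wt | _, _ => 0 end)))).
  set (wtt := - (total_t (surface_t xi phi) (mkjet x t (fun i j =>
     match i, j with
     | 0%nat, 0%nat => u | 1%nat, 0%nat => p | 2%nat, 0%nat => q | 3%nat, 0%nat => r
     | 0%nat, 1%nat => w | 1%nat, 1%nat => wx | 2%nat, 1%nat => wxx
     | 0%nat, 2%nat => wt | 1%nat, 2%nat => wtx | _, _ => 0 end)))).
  set (z := mkjet x t (fun i j =>
     match i, j with
     | 0%nat, 0%nat => u | 1%nat, 0%nat => p | 2%nat, 0%nat => q | 3%nat, 0%nat => r
     | 0%nat, 1%nat => w | 1%nat, 1%nat => wx | 2%nat, 1%nat => wxx
     | 0%nat, 2%nat => wt | 1%nat, 2%nat => wtx | 0%nat, 3%nat => wtt | _, _ => 0 end)).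
  assert (HJ : vanishes_upto 3 1 (Delta2 xi (fun _ _ _ => 1) phi) z).
  { intros i j Hij. rewrite Delta2_surface.
    destruct i as [|[|[|i]]], j as [|[|[|j]]]; try (exfalso; lia); unfold DJ; simpl.
    - unfold surface, coord, lift; simpl. rewrite Hw; ring.
    - rewrite total_t_surface by assumption.
      unfold surface_t, coord, lift; simpl. unfold wt; ring.
    - rewrite total_t_surface, total_t_surface_t by assumption.
      unfold coord, lift; simpl; unfold wtt.
      rewrite total_t_surface_t by assumption. unfold coord, lift; simpl; ring.
    - rewrite total_x_surface by assumption.
      unfold surface_x, coord, lift; simpl. rewrite Hwx; unfold Ex; ring.
    - rewrite total_t_surface by assumption. rewrite total_x_surface_t by assumption.
      unfold surface_tx, coord, lift; simpl; unfold wtx.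
      rewrite total_x_surface_t by assumption. unfold surface_tx, coord, lift; simpl; ring.
    - rewrite total_x_surface, total_x_surface_x by assumption.
      unfold lift_x, lift_xx, coord, lift; simpl. rewrite Hwxx; unfold Ex, Exx; ring. }
  assert (H1 : vanishes_upto 3 3 Delta1 z).
  { intros i j Hij. destruct i, j; try (exfalso; lia).
    unfold DJ, Delta1, coord; simpl. rewrite <- HD; ring. }
  specialize (Hs z H1 HJ). rewrite prolong4_Delta1, !phiJ_surface in Hs.
  rewrite <- Delta2_surface in Hs.
  (* Only D_x and D_t of the surface condition are discarded. D_xxt of it has order 4, is not
     assumed to vanish, and carries the content of the condition. *)
  rewrite (HJ 1%nat 0%nat), (HJ 0%nat 1%nat), Delta2_surface in Hs by lia.
  unfold DJ in Hs; simpl in Hs.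
  rewrite total_t_surface, total_x_surface_t, total_x_surface_tx in Hs by assumption.
  rewrite <- Hs.
  unfold lift_x, lift_xx, Ex, Exx, lift, coord; simpl.
  fold wt. ring.
Qed.

(** For a translation, [xi u_Jx + u_Jt] cancels against D_J of the surface condition, so every
    [phiJ] is 0 at every jet. *)
Lemma constant_symmetry c :
  nonclassical_symmetry (fun _ _ _ => c) (fun _ _ _ => 1) (fun _ _ _ => 0).
Proof.
  intros z _ _.
  rewrite prolong4_Delta1, !phiJ_surface. unfold DJ; simpl.
  rewrite total_x_surface, total_t_surface, total_x_surface_t, total_x_surface_tx
    by apply smooth_const.
  unfold surface_x, surface_t, lift_x, lift_xx.
  rewrite ?dt_const, ?du_const, ?dx_const.
  unfold lift. ring.
Qed.

(** * Derivatives on the line and differential equations *)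

Lemma is_derive_eq (f : R -> R) (x a b : R) : is_derive f x a -> a = b -> is_derive f x b.
Proof. now intros H <-. Qed.
Lemma is_derive_Rconst (c x : R) : is_derive (fun _ => c) x 0.
Proof. apply (is_derive_const (V := R_NormedModule)). Qed.
Lemma is_derive_Rid (x : R) : is_derive (fun s => s) x 1.
Proof. apply (is_derive_id (K := R_AbsRing)). Qed.
Lemma is_derive_Rplus (f g : R -> R) (x a b : R) : is_derive f x a -> is_derive g x b ->
  is_derive (fun s => f s + g s) x (a + b).
Proof. apply (is_derive_plus (K := R_AbsRing) (V := R_NormedModule)). Qed.
Lemma is_derive_Rminus (f g : R -> R) (x a b : R) : is_derive f x a -> is_derive g x b ->
  is_derive (fun s => f s - g s) x (a - b).
Proof. apply (is_derive_minus (K := R_AbsRing) (V := R_NormedModule)). Qed.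
Lemma is_derive_Ropp (f : R -> R) (x a : R) : is_derive f x a -> is_derive (fun s => - f s) x (- a).
Proof. apply (is_derive_opp (K := R_AbsRing) (V := R_NormedModule)). Qed.
Lemma is_derive_Rmult (f g : R -> R) (x a b : R) : is_derive f x a -> is_derive g x b ->
  is_derive (fun s => f s * g s) x (a * g x + f x * b).
Proof. intros Hf Hg; apply (is_derive_mult f g x a b Hf Hg), Rmult_comm. Qed.

Ltac diff :=
  lazymatch goal with
  | |- is_derive (fun _ => ?c) _ _ => apply (is_derive_Rconst c)
  | |- is_derive (fun s => s) _ _ => apply is_derive_Rid
  | |- is_derive (fun s => @?f s + @?g s) _ _ => eapply (is_derive_Rplus f g); [diff | diff]
  | |- is_derive (fun s => @?f s - @?g s) _ _ => eapply (is_derive_Rminus f g); [diff | diff]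
  | |- is_derive (fun s => @?f s * @?g s) _ _ => eapply (is_derive_Rmult f g); [diff | diff]
  | |- is_derive (fun s => - @?f s) _ _ => eapply (is_derive_Ropp f); diff
  | |- is_derive (fun s => ?f s ?t ?u) _ _ => apply (is_derive_dx f); smooth
  | |- is_derive (fun s => ?f ?x s ?u) _ _ => apply (is_derive_dt f); smooth
  | |- is_derive (fun s => ?f ?x ?t s) _ _ => apply (is_derive_du f); smooth
  | |- is_derive (?f ?x ?t) _ _ => apply (is_derive_du f); smooth
  end.

Lemma continuous_of_derive (f : R -> R) x l : is_derive f x l -> continuous f x.
Proof. intros H; apply (ex_derive_continuous f); now exists l. Qed.

(** By continuity [h] is nonzero near [y], so [f] is locally 0. This is what allows equations known
    only where [h] does not vanish to be differentiated. *)
Lemma vanish_derive (h f : R -> R) (y k l : R) :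
  is_derive h y k -> h y <> 0 -> (forall s, h s <> 0 -> f s = 0) ->
  is_derive f y l -> l = 0.
Proof.
  intros Hh Hy Hf Hl.
  rewrite <- (is_derive_unique _ _ _ Hl).
  rewrite <- (Derive_const 0 y).
  apply Derive_ext_loc.
  apply continuous_of_derive in Hh.
  assert (L : locally (h y) (fun v => v <> 0)).
  { exists (mkposreal _ (Rabs_pos_lt _ Hy)); intros v Hv E; subst v.
    unfold ball in Hv; simpl in Hv. unfold AbsRing_ball, abs, minus, plus, opp in Hv; simpl in Hv.
    rewrite Rplus_0_l, Rabs_Ropp in Hv. lra. }
  specialize (Hh _ L). change (locally y (fun s => h s <> 0)) in Hh.
  revert Hh; apply filter_imp; intros s; apply Hf.
Qed.

Lemma constant_of_derive_0 (f : R -> R) :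
  (forall s, is_derive f s 0) -> forall a b, f a = f b.
Proof.
  intros H a b. destruct (Rtotal_order a b) as [L|[->|L]]; [|reflexivity|].
  - apply (eq_is_derive f a b); [intros t _; apply H | exact L].
  - symmetry; apply (eq_is_derive f b a); [intros t _; apply H | exact L].
Qed.

(** The square of [f] has derivative 0, so it is constant: [f] vanishes everywhere or nowhere, and
    [f'] is 0 in both cases. *)
Lemma derive_0_of_mult (f f' : R -> R) :
  (forall s, is_derive f s (f' s)) -> (forall s, f s * f' s = 0) -> forall s, f' s = 0.
Proof.
  intros Hf H s.
  destruct (Req_dec (f s) 0) as [E|E].
  - assert (Z : forall y, f y = 0).
    { intros y. apply Rsqr_0_uniq. replace 0 with (f s * f s) by (rewrite E; ring).
      apply (constant_of_derive_0 (fun s => f s * f s)). intros w.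
      replace 0 with (f' w * f w + f w * f' w) by (specialize (H w); lra).
      now apply is_derive_Rmult. }
    rewrite <- (is_derive_unique _ _ _ (Hf s)).
    rewrite (Derive_ext _ (fun _ => 0)) by exact Z. apply Derive_const.
  - destruct (Rmult_integral _ _ (H s)); tauto.
Qed.

(** With the integrating factor, [y * exp (- RInt a s0)] is constant. *)
Lemma linear_ode_nonzero (a y : R -> R) s0 :
  (forall s, continuous a s) -> (forall s, is_derive y s (a s * y s)) ->
  y s0 <> 0 -> forall s, y s <> 0.
Proof.
  intros Ha Hy H0 s Hs.
  assert (HA : forall s, is_derive (fun b => RInt a s0 b) s (a s)).
  { intros b. apply (is_derive_RInt a _ s0).
    - apply filter_forall; intros c.
      apply (RInt_correct (V := R_CompleteNormedModule)), (ex_RInt_continuous (V := R_CompleteNormedModule)).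
      intros; apply Ha.
    - apply Ha. }
  assert (E := constant_of_derive_0 (fun b => y b * exp (- RInt a s0 b))).
  assert (D : forall b, is_derive (fun b => y b * exp (- RInt a s0 b)) b 0).
  { intros b.
    replace 0 with (a b * y b * exp (- RInt a s0 b)
      + y b * (- a b * exp (- RInt a s0 b))) by ring.
    apply (is_derive_Rmult y (fun b => exp (- RInt a s0 b))); [apply Hy|].
    apply (is_derive_comp exp (fun b => - RInt a s0 b) b).
    - apply is_derive_exp.
    - apply is_derive_Ropp, HA. }
  specialize (E D s0 s). simpl in E. rewrite Hs, Rmult_0_l in E.
  destruct (Rmult_integral _ _ E) as [Z|Z]; [tauto|].
  pose proof (exp_pos (- RInt a s0 s0)); lra.
Qed.

(** The square of [a] satisfies the linear equation with coefficient [2 * a] even at zeros of [a],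
    so a nonzero [a] never vanishes. Then [/ a + s] is constant, and the solution would blow up in
    finite time. *)
Lemma global_riccati (a a' : R -> R) :
  (forall s, is_derive a s (a' s)) -> (forall s, a s <> 0 -> a' s = a s * a s) ->
  forall s, a s = 0.
Proof.
  intros Ha H s0.
  destruct (Req_dec (a s0) 0) as [E|E]; [exact E|exfalso].
  assert (NZ : forall s, a s <> 0).
  { intros s Z.
    apply (linear_ode_nonzero (fun s => 2 * a s) (fun s => a s * a s) s0) with s.
    - intros y. eapply continuous_of_derive.
      apply (is_derive_Rmult (fun _ => 2) a); [apply (is_derive_const (V := R_NormedModule))| apply Ha].
    - intros y.
      replace (2 * a y * (a y * a y)) with (a' y * a y + a y * a' y).
      { now apply is_derive_Rmult. }
      destruct (Req_dec (a y) 0) as [Z'|Z']; [rewrite Z'; ring | rewrite (H y Z'); ring].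
    - now apply Rmult_integral_contrapositive.
    - rewrite Z; ring. }
  assert (C := constant_of_derive_0 (fun s => / a s + s)).
  assert (D : forall s, is_derive (fun s => / a s + s) s 0).
  { intros s. replace 0 with (- a' s / (a s) ^ 2 + 1).
    - apply (is_derive_Rplus (fun s => / a s) (fun s => s)).
      + apply is_derive_inv; [apply Ha | apply NZ].
      + apply (is_derive_id (K := R_AbsRing)).
    - rewrite (H s (NZ s)). field. apply NZ. }
  (* [k] is the blow-up time: constancy gives [/ a k + k = k], hence [/ a k = 0]. *)
  set (k := / a s0 + s0) in *.
  specialize (C D k s0). simpl in C. fold k in C.
  apply (Rinv_neq_0_compat _ (NZ k)). lra.
Qed.

Lemma affine_u f x t : smooth f -> (forall u, du (du f) x t u = 0) ->
  forall u, f x t u = f x t 0 + u * du f x t 0 /\ du f x t u = du f x t 0.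
Proof.
  intros Hf H.
  assert (E : forall u, du f x t u = du f x t 0).
  { intros u. apply (constant_of_derive_0 (fun s => du f x t s)).
    intros s; rewrite <- (H s); apply is_derive_du; smooth. }
  intros u; split; [|apply E].
  assert (C := constant_of_derive_0 (fun s => f x t s - s * du f x t 0)).
  simpl in C. rewrite <- (Rplus_0_r (f x t u)).
  enough (f x t u - u * du f x t 0 = f x t 0 - 0 * du f x t 0) by lra.
  apply C. intros s.
  eapply is_derive_eq; [diff|]. rewrite (E s); ring.
Qed.

Lemma eq_at_u0 f : smooth f -> du f = (fun _ _ _ => 0) ->
  forall x t u, f x t u = f x t 0.
Proof.
  intros Hf E x t u. apply (constant_of_derive_0 (fun s => f x t s)).
  intros s. eapply is_derive_eq; [now apply is_derive_du | now rewrite E].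
Qed.

(* [E] : the derivative at [y] of the left-hand side of [H], an equation valid
   where [h] does not vanish, is zero. *)
Ltac vanish E h y H :=
  eassert (E : _ = 0);
  [ eapply (vanish_derive h _ y);
    [ cbv beta; diff | cbv beta; assumption
    | let s := fresh in let hs := fresh in
      intros s hs; cbv beta in hs; first [exact (H _ _ _ hs) | exact (H _ _ hs) | exact (H _ hs)]
    | cbv beta; diff ] | ].

(** * The case xi = 0 *)

Lemma phi_0_of_xi_0 phi : smooth phi ->
  nonclassical_symmetry (fun _ _ _ => 0) (fun _ _ _ => 1) phi ->
  forall x t u, phi x t u = 0.
Proof.
  intros Hphi Hs.
  (* With [xi = 0] the coordinate r disappears from the condition, and u_xxt is replaced by its
     value from [Delta1 = 0]. *)
  assert (HC : forall x t u p q,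
    phi x t u + (1 + u) * p = Exx phi x t u p q ->
    phi x t u * p + (1 + u) * Ex phi x t u p
    + dt phi x t u + phi x t u * du phi x t u
    - (Exx (dt phi) x t u p q + (phi x t u + (1 + u) * p) * du phi x t u
       + 2 * Ex phi x t u p * Ex (du phi) x t u p + phi x t u * Exx (du phi) x t u p q) = 0).
  { intros x t u p q E.
    assert (S := symmetry_condition _ phi x t u p q 0 _ _ _ (smooth_const 0) Hphi Hs
      eq_refl eq_refl eq_refl).
    unfold Ex, Exx in *.
    rewrite ?dt_const, ?du_const, ?dx_const in S.
    etransitivity; [|apply S]; [rewrite E; ring | lra]. }
  set (g := du phi) in *.
  assert (Hg : smooth g) by (unfold g; smooth).
  (* [n / g] is independent of [u] where [g <> 0]: this is [e2] below. *)
  pose (n := fun x t u => dt g x t u + phi x t u * du g x t u + g x t u * g x t u).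
  assert (Hn : smooth n) by (unfold n; smooth).
  assert (Nn : forall x t u, n x t u =
    dt g x t u + phi x t u * du g x t u + g x t u * g x t u) by reflexivity.
  assert (Nx : forall x t u, dx n x t u = dx (dt g) x t u
    + (dx phi x t u * du g x t u + phi x t u * dx (du g) x t u) + 2 * g x t u * dx g x t u).
  { intros x t u. apply is_derive_unique. eapply is_derive_eq; [unfold n; cbv beta; diff|]. ring. }
  assert (Nu : forall x t u, du n x t u = dt (du g) x t u
    + (g x t u * du g x t u + phi x t u * du (du g) x t u) + 2 * g x t u * du g x t u).
  { intros x t u. apply is_derive_unique. eapply is_derive_eq; [unfold n; cbv beta; diff|].
    rewrite du_dt by smooth. unfold g. ring. }
  assert (Nuu : forall x t u, du (du n) x t u = dt (du (du g)) x t u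
    + phi x t u * du (du (du g)) x t u + 3 * du g x t u * du g x t u
    + 4 * g x t u * du (du g) x t u).
  { intros x t u.
    replace (du n) with (fun x t u => dt (du g) x t u
      + (g x t u * du g x t u + phi x t u * du (du g) x t u) + 2 * g x t u * du g x t u)
      by (symmetry; apply fun3_ext; exact Nu).
    apply is_derive_unique. eapply is_derive_eq; [cbv beta; diff|].
    rewrite du_dt by smooth. unfold g. ring. }
  clearbody n.
  (* The coefficient of q in the constraint of [HC] is [g]. Solving for q and multiplying by [g]
     leaves a polynomial of degree 2 in p, with p free. *)
  assert (HP : forall x t u p, g x t u <> 0 ->
    g x t u * (phi x t u * p + (1 + u) * Ex phi x t u p + dt phi x t u + phi x t u * g x t u
      - (dx (dx (dt phi)) x t u + 2 * p * dx (dt g) x t u + p * p * dt (du g) x t u)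
      - (phi x t u + (1 + u) * p) * g x t u
      - 2 * Ex phi x t u p * Ex g x t u p
      - phi x t u * (dx (dx g) x t u + 2 * p * dx (du g) x t u + p * p * du (du g) x t u))
    - (dt g x t u + phi x t u * du g x t u) * (phi x t u + (1 + u) * p
      - dx (dx phi) x t u - 2 * p * dx g x t u - p * p * du g x t u) = 0).
  { intros x t u p H.
    assert (S := HC x t u p ((phi x t u + (1 + u) * p
      - dx (dx phi) x t u - 2 * p * dx g x t u - p * p * du g x t u) / g x t u)).
    unfold Ex, Exx in *.
    rewrite !du_dt in S by smooth. fold g in S |- *.
    rewrite <- (Rmult_0_r (g x t u)), <- S by (field; exact H). clear S.
    field; exact H. }
  (* The coefficient of p^2 in [HP], up to sign. *)
  assert (e2 : forall x t u, g x t u <> 0 -> g x t u * du n x t u - n x t u * du g x t u = 0).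
  { intros x t u H. assert (P1 := HP x t u 1 H). assert (P2 := HP x t u (-1) H).
    assert (P3 := HP x t u 0 H). rewrite Nu, Nn. unfold Ex in *. fold g in P1, P2, P3. lra. }
  (* The coefficient of p in [HP], up to sign. *)
  assert (e1 : forall x t u, g x t u <> 0 ->
    2 * (dx n x t u * g x t u - n x t u * dx g x t u)
    + (n x t u - g x t u * g x t u) * (1 + u) - phi x t u * g x t u = 0).
  { intros x t u H. assert (P1 := HP x t u 1 H). assert (P2 := HP x t u (-1) H).
    rewrite Nx, Nn. unfold Ex in *. fold g in P1, P2. lra. }
  clear HP Nx.
  (* Put m = n / g. Then [e2] says m_u = 0 and [e1] expresses m_x through g, n, phi and u; [R0] is
     the compatibility m_xu = m_ux. *)
  assert (R0 : forall x t u, g x t u <> 0 ->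
    (phi x t u * g x t u - n x t u * (1 + u)) * du g x t u
    + g x t u * (n x t u - 2 * (g x t u * g x t u)) = 0).
  { intros x t u H.
    vanish e2x (fun s => g s t u) x e2.
    vanish e1u (fun s => g x t s) u e1.
    rewrite !du_dx in e1u by smooth. fold g in e1u.
    assert (E2 := e2 x t u H). assert (E1 := e1 x t u H).
    lazymatch type of e1u with ?A = 0 => lazymatch type of e2x with ?B = 0 =>
    lazymatch type of E2 with ?C = 0 => lazymatch type of E1 with ?D = 0 =>
      replace 0 with (g x t u * A - 2 * du g x t u * D - 2 * g x t u * B
        + 4 * dx g x t u * C - (1 + u) * C) by (rewrite e1u, e2x, E2, E1; ring)
    end end end end.
    ring. }
  (* [R0] and its u-derivative are both linear in [phi * g - n * (1 + u)], the only place where phi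
     and u remain; eliminating it gives [R1]. *)
  assert (R1 : forall x t u, g x t u <> 0 ->
    (n x t u - 2 * (g x t u * g x t u)) * du (du g) x t u
    + 3 * g x t u * (du g x t u * du g x t u) = 0).
  { intros x t u H.
    vanish R0u (fun s => g x t s) u R0.
    fold g in R0u.
    assert (E2 := e2 x t u H). assert (Z := R0 x t u H).
    assert (K : (phi x t u * g x t u - n x t u * (1 + u)) * du (du g) x t u
       - 3 * g x t u * g x t u * du g x t u = 0).
    { apply (Rmult_eq_reg_l (g x t u)); [|exact H].
      lazymatch type of R0u with ?A = 0 => lazymatch type of Z with ?B = 0 =>
      lazymatch type of E2 with ?C = 0 =>
        replace (g x t u * 0) with (g x t u * A + du g x t u * B
          - (- (1 + u) * du g x t u + g x t u) * C - 2 * du g x t u * B)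
          by (rewrite R0u, Z, E2; ring) end end end.
      ring. }
    apply (Rmult_eq_reg_l (g x t u)); [|exact H].
    lazymatch type of K with ?A = 0 => lazymatch type of Z with ?B = 0 =>
      replace (g x t u * 0) with (du (du g) x t u * B - du g x t u * A)
        by (rewrite K, Z; ring) end end.
    ring. }
  assert (e2t : forall x t u, g x t u <> 0 ->
    g x t u * dt (du n) x t u + dt g x t u * du n x t u
    - dt n x t u * du g x t u - n x t u * dt (du g) x t u = 0).
  { intros x t u H. vanish E (fun s => g x s u) t e2. rewrite <- E; ring. }
  (* [R1] involves [g], [n] and their u-derivatives only; this is [R1] differentiated
     along [d_t + phi d_u], a derivation whose effect on [g], [g_u], [g_uu] is known. *)
  assert (R2 : forall x t u, g x t u * du (du g) x t u <> 0 ->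
    g x t u * dt n x t u - n x t u * dt g x t u
    - 2 * n x t u * (g x t u * g x t u)
    + 2 * (g x t u * g x t u) * (g x t u * g x t u) = 0).
  { intros x t u Hc.
    assert (H : g x t u <> 0) by (intros Z; apply Hc; rewrite Z; ring).
    vanish R1t (fun s => g x s u) t R1.
    vanish R1u (fun s => g x t s) u R1.
    vanish E2u (fun s => g x t s) u e2.
    assert (E2 := e2 x t u H). assert (Z := R1 x t u H).
    assert (At : dt g x t u = n x t u - phi x t u * du g x t u - g x t u * g x t u)
      by (rewrite Nn; ring).
    assert (Bt : dt (du g) x t u = du n x t u - 3 * g x t u * du g x t u
      - phi x t u * du (du g) x t u) by (rewrite Nu; ring).
    assert (Ct : dt (du (du g)) x t u = du (du n) x t u - phi x t u * du (du (du g)) x t u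
      - 3 * du g x t u * du g x t u - 4 * g x t u * du (du g) x t u) by (rewrite Nuu; ring).
    apply (Rmult_eq_reg_l (du (du g) x t u)); [|intros Z'; apply Hc; rewrite Z'; ring].
    rewrite Rmult_0_r.
    lazymatch type of R1t with ?A = 0 => lazymatch type of R1u with ?B = 0 =>
    lazymatch type of E2u with ?C = 0 => lazymatch type of E2 with ?D = 0 =>
    lazymatch type of Z with ?E = 0 =>
      replace 0 with (g x t u * (A + phi x t u * B)
        - (phi x t u * du (du g) x t u + 6 * g x t u * du g x t u) * D
        - (n x t u - 2 * (g x t u * g x t u)) * C
        - (2 * n x t u - 5 * (g x t u * g x t u)) * E)
        by (rewrite R1t, R1u, E2u, E2, Z; ring) end end end end end.
    rewrite At, Bt, Ct. ring. }
  (* With m = n / g, [R2] reads m_t - 2 m g + 2 g^2 = 0. Since m_u = 0, its u-derivative gives g_u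
     (m - 2 g) = 0, and for m = 2 g [R1] becomes 3 g g_u^2 = 0. *)
  assert (Hb : forall x t u, g x t u * du (du g) x t u <> 0 -> du g x t u = 0).
  { intros x t u Hc.
    assert (H : g x t u <> 0) by (intros Z; apply Hc; rewrite Z; ring).
    vanish E (fun s => g x t s * du (du g) x t s) u R2.
    rewrite !du_dt in E by smooth.
    assert (E2 := e2 x t u H). assert (E2t := e2t x t u H).
    assert (Z := R1 x t u H). assert (T := R2 x t u Hc).
    assert (K : du g x t u * (n x t u - 2 * (g x t u * g x t u)) = 0).
    { apply (Rmult_eq_reg_l (- 2 * (g x t u * g x t u))).
      2: { intros Z'. apply H. nra. }
      rewrite Rmult_0_r.
      lazymatch type of E with ?A = 0 => lazymatch type of E2t with ?B = 0 =>
      lazymatch type of E2 with ?C = 0 => lazymatch type of T with ?D = 0 =>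
        replace 0 with (g x t u * A - g x t u * B
          + (2 * dt g x t u + 2 * (g x t u * g x t u)) * C - 2 * du g x t u * D)
         by (rewrite E, E2t, E2, T; ring) end end end end.
      ring. }
    destruct (Req_dec (du g x t u) 0) as [Q|Q]; [exact Q|].
    assert (L : n x t u - 2 * (g x t u * g x t u) = 0)
      by (destruct (Rmult_integral _ _ K); tauto).
    rewrite L in Z. assert (du g x t u * du g x t u = 0); [|nra].
    apply (Rmult_eq_reg_l (g x t u)); [lra | exact H]. }
  (* Where [g] and g_uu are both nonzero, differentiating [Hb] contradicts g_uu <> 0. Hence g_uu = 0
     where [g <> 0], and [R1] gives g_u = 0 there. *)
  assert (Hb' : forall x t u, g x t u * du g x t u = 0).
  { intros x t u.
    destruct (Req_dec (g x t u) 0) as [Z|Z]; [rewrite Z; ring|].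
    assert (C : du (du g) x t u = 0).
    { destruct (Req_dec (du (du g) x t u) 0) as [Q|Q]; [exact Q|exfalso].
      assert (Hc : g x t u * du (du g) x t u <> 0) by now apply Rmult_integral_contrapositive.
      vanish E (fun s => g x t s * du (du g) x t s) u Hb. tauto. }
    assert (L := R1 x t u Z). rewrite C in L.
    assert (du g x t u * du g x t u = 0); [|nra].
    apply (Rmult_eq_reg_l (g x t u)); [lra | exact Z]. }
  (* Once g_u = 0, [R0] reduces to n = 2 g^2, which is the Riccati equation g_t = g^2. *)
  assert (G : forall x t u, g x t u = 0).
  { intros x t u. apply (global_riccati (fun s => g x s u) (fun s => dt g x s u)).
    - intros s; apply is_derive_dt; smooth.
    - intros s H.
      assert (B : du g x s u = 0).
      { apply (derive_0_of_mult (fun u => g x s u) (fun u => du g x s u)); [|apply Hb'].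
        intros w; apply is_derive_du; smooth. }
      assert (Z := R0 x s u H). rewrite Nn, B in Z.
      apply (Rmult_eq_reg_l (g x s u)); [lra | exact H]. }
  clear - Hphi HC Hg G.
  assert (G0 : du phi = fun _ _ _ => 0) by (apply fun3_ext; exact G).
  (* Now [Delta1 = 0] is solved for p instead, and the condition is multiplied by [1 + u]: a
     quadratic in [1 + u] with coefficients depending on (x,t). *)
  assert (HQ : forall x t u, 1 + u <> 0 ->
    phi x t 0 * (dx (dx phi) x t 0 - phi x t 0) + (1 + u) * (1 + u) * dx phi x t 0
    - (1 + u) * (dx (dx (dt phi)) x t 0 - dt phi x t 0) = 0).
  { intros x t u Hu.
    assert (S := HC x t u ((dx (dx phi) x t u - phi x t u) / (1 + u)) 0).
    unfold g, Ex, Exx in S.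
    rewrite !du_dt in S by smooth.
    rewrite G0, ?dx_const, ?dt_const, ?du_const, ?dx_const, ?dt_const in S.
    rewrite (eq_at_u0 (dx (dx phi))), (eq_at_u0 (dx (dx (dt phi)))), (eq_at_u0 (dx phi)), (eq_at_u0 (dt phi)),
      (eq_at_u0 phi) in S
      by (smooth || (rewrite ?du_dx, ?du_dt by smooth; rewrite G0, ?dt_const, ?dx_const; reflexivity)).
    lazymatch type of S with _ -> ?A = 0 => transitivity ((1 + u) * A) end.
    - field; exact Hu.
    - rewrite S; [ring | field; exact Hu]. }
  (* At u = 0, 1, -2 the quantity [1 + u] is 1, 2, -1, enough to isolate the leading coefficient
     phi_x. The constant one then reduces to -phi^2. *)
  assert (X0 : forall x t u, dx phi x t u = 0).
  { intros x t u.
    rewrite (eq_at_u0 (dx phi)) by (smooth || (rewrite du_dx by smooth; rewrite G0, dx_const; reflexivity)).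
    assert (A1 := HQ x t 0 ltac:(lra)). assert (A2 := HQ x t 1 ltac:(lra)).
    assert (A3 := HQ x t (-2) ltac:(lra)). lra. }
  intros x t u. rewrite (eq_at_u0 phi Hphi G0).
  assert (XX : dx (dx phi) x t 0 = 0).
  { replace (dx phi) with (fun _ _ _ : R => 0) by (symmetry; apply fun3_ext; exact X0).
    now rewrite dx_const. }
  assert (A1 := HQ x t 0 ltac:(lra)).
  assert (A3 := HQ x t (-2) ltac:(lra)). rewrite XX, X0 in A1, A3. nra.
Qed.

(** * The case xi <> 0 *)

(** The coefficient of r in u_xxt is [- xi], so [Delta1 = 0] determines r. Multiplying by [xi]
    clears the denominator and leaves p and q free. *)
Lemma symmetry_condition_r xi phi (x t u p q : R) :
  smooth xi -> smooth phi ->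
  nonclassical_symmetry xi (fun _ _ _ => 1) phi -> xi x t u <> 0 ->
  let w := phi x t u - xi x t u * p in
  let wx := Ex phi x t u p - Ex xi x t u p * p - xi x t u * q in
  let wxx := w + (1 + u) * p in
  xi x t u * (
    phi x t u * p + (1 + u) * (xi x t u * q + wx)
    + (dt phi x t u + w * du phi x t u - (dt xi x t u + w * du xi x t u) * p)
    - (Exx (dt phi) x t u p q + wxx * du phi x t u + 2 * wx * Ex (du phi) x t u p
     + w * Exx (du phi) x t u p q
     - (Exx (dt xi) x t u p q + wxx * du xi x t u + 2 * wx * Ex (du xi) x t u p
        + w * Exx (du xi) x t u p q) * p
     - 2 * (Ex (dt xi) x t u p + wx * du xi x t u + w * Ex (du xi) x t u p) * q
     - Exx xi x t u p q * wx - 2 * Ex xi x t u p * wxx))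
  + (dt xi x t u + w * du xi x t u) *
    (Exx phi x t u p q - Exx xi x t u p q * p - 2 * Ex xi x t u p * q - wxx) = 0.
Proof.
  intros Hxi Hphi Hs H w wx wxx.
  assert (S := symmetry_condition xi phi x t u p q
    ((Exx phi x t u p q - Exx xi x t u p q * p - 2 * Ex xi x t u p * q - wxx) / xi x t u)
    w wx wxx Hxi Hphi Hs eq_refl eq_refl).
  lazymatch type of S with _ -> _ -> ?A = 0 => transitivity (xi x t u * A) end.
  - field; exact H.
  - rewrite S; [ring | field; exact H | reflexivity].
Qed.

(** At p = 0 the coefficient of q^2 is -3 xi^2 xi_u; the second difference at q = 1, -1, 0 extracts
    it. *)
Lemma du_xi_0 xi phi : smooth xi -> smooth phi ->
  nonclassical_symmetry xi (fun _ _ _ => 1) phi -> forall x t u, du xi x t u = 0.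
Proof.
  intros Hxi Hphi Hs x t.
  apply (derive_0_of_mult (fun u => xi x t u) (fun u => du xi x t u)).
  { intros u; now apply is_derive_du. }
  intros u. destruct (Req_dec (xi x t u) 0) as [Z|H]; [rewrite Z; ring|].
  assert (P1 := symmetry_condition_r xi phi x t u 0 1 Hxi Hphi Hs H).
  assert (P2 := symmetry_condition_r xi phi x t u 0 (-1) Hxi Hphi Hs H).
  assert (P3 := symmetry_condition_r xi phi x t u 0 0 Hxi Hphi Hs H).
  cbv zeta in P1, P2, P3. unfold Ex, Exx in P1, P2, P3.
  apply (Rmult_eq_reg_l (xi x t u)); [|exact H]. lra.
Qed.

Lemma symmetry_condition_xi xi phi (x t u p q : R) :
  smooth xi -> smooth phi ->
  nonclassical_symmetry xi (fun _ _ _ => 1) phi ->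
  xi x t 0 <> 0 ->
  let X := xi x t 0 in
  let w := phi x t u - X * p in
  let wx := Ex phi x t u p - dx xi x t 0 * p - X * q in
  let wxx := w + (1 + u) * p in
  X * (
    phi x t u * p + (1 + u) * (X * q + wx)
    + (dt phi x t u + w * du phi x t u - dt xi x t 0 * p)
    - (Exx (dt phi) x t u p q + wxx * du phi x t u + 2 * wx * Ex (du phi) x t u p
     + w * Exx (du phi) x t u p q
     - dx (dx (dt xi)) x t 0 * p - 2 * dx (dt xi) x t 0 * q
     - dx (dx xi) x t 0 * wx - 2 * dx xi x t 0 * wxx))
  + dt xi x t 0 *
    (Exx phi x t u p q - dx (dx xi) x t 0 * p - 2 * dx xi x t 0 * q - wxx) = 0.
Proof.
  intros Hxi Hphi Hs H.
  assert (U0 : du xi = fun _ _ _ => 0) by (apply fun3_ext; now apply (du_xi_0 xi phi)).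
  assert (H' : xi x t u <> 0) by now rewrite eq_at_u0.
  assert (S := symmetry_condition_r xi phi x t u p q Hxi Hphi Hs H').
  cbv zeta in *.
  unfold Ex, Exx in *.
  rewrite (du_dt xi) in S by smooth.
  rewrite U0, ?dx_const, ?dt_const, ?du_const, ?dx_const, ?dt_const in S.
  rewrite (eq_at_u0 (dx (dx xi))), (eq_at_u0 (dx (dx (dt xi)))), (eq_at_u0 (dx (dt xi))), (eq_at_u0 (dx xi)), (eq_at_u0 (dt xi)),
      (eq_at_u0 xi) in S
      by (smooth || (rewrite ?du_dx, ?du_dt by smooth; rewrite U0, ?dt_const, ?dx_const; reflexivity)).
  etransitivity; [|exact S]. ring.
Qed.

(** * Coefficient equations where [xi] does not vanish *)

Section NonzeroXi.
Variables xi phi : R -> R -> R -> R.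
Hypothesis Hxi : smooth xi.
Hypothesis Hphi : smooth phi.
Hypothesis Hs : nonclassical_symmetry xi (fun _ _ _ => 1) phi.

(** The coefficient of pq is 3 xi^2 phi_uu; the mixed second difference over p, q = 1, -1 extracts
    it. *)
Lemma duu_phi_0 x t u : xi x t 0 <> 0 -> du (du phi) x t u = 0.
Proof.
  intros H.
  assert (P1 := symmetry_condition_xi xi phi x t u 1 1 Hxi Hphi Hs H).
  assert (P2 := symmetry_condition_xi xi phi x t u 1 (-1) Hxi Hphi Hs H).
  assert (P3 := symmetry_condition_xi xi phi x t u (-1) 1 Hxi Hphi Hs H).
  assert (P4 := symmetry_condition_xi xi phi x t u (-1) (-1) Hxi Hphi Hs H).
  cbv zeta in *. unfold Ex, Exx in *.
  apply (Rmult_eq_reg_l (xi x t 0 * xi x t 0)); [lra|].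
  now apply Rmult_integral_contrapositive.
Qed.

(** With phi affine in u, the condition is polynomial in u as well as in p and q, so the
    coefficients of powers of u can also be separated. *)
Lemma symmetry_condition_affine : forall x t u, xi x t 0 <> 0 -> forall p q,
  let X := xi x t 0 in let Xx := dx xi x t 0 in let Xxx := dx (dx xi) x t 0 in
  let Xt := dt xi x t 0 in
  let a := du phi x t 0 in let ax := dx (du phi) x t 0 in let axx := dx (dx (du phi)) x t 0 in
  let f := phi x t 0 + u * a in
  let fx := dx phi x t 0 + u * ax in
  let fxx := dx (dx phi) x t 0 + u * axx in
  let w := f - X * p in
  let wx := fx + p * a - Xx * p - X * q in
  let wxx := w + (1 + u) * p in
  X * (
    f * p + (1 + u) * (X * q + wx)
    + (dt phi x t 0 + u * dt (du phi) x t 0 + w * a - Xt * p)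
    - (dx (dx (dt phi)) x t 0 + u * dx (dx (dt (du phi))) x t 0
       + 2 * p * dx (dt (du phi)) x t 0 + q * dt (du phi) x t 0
       + wxx * a + 2 * wx * ax + w * axx
     - dx (dx (dt xi)) x t 0 * p - 2 * dx (dt xi) x t 0 * q
     - Xxx * wx - 2 * Xx * wxx))
  + Xt * (fxx + 2 * p * ax + q * a - Xxx * p - 2 * Xx * q - wxx) = 0.
Proof.
  intros x t u H p q.
  assert (S := symmetry_condition_xi xi phi x t u p q Hxi Hphi Hs H).
  assert (Z : forall x t u, xi x t 0 <> 0 -> du (du phi) x t u = 0)
    by (intros; now apply duu_phi_0).
  (* Since phi_uu vanishes on the open set [xi <> 0], so do its x- and t-derivatives; hence the
     derivatives of phi used below are affine in u too. *)
  assert (Zx : forall x t u, xi x t 0 <> 0 -> dx (du (du phi)) x t u = 0).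
  { intros y s v K. vanish E (fun y => xi y s 0) y (fun y => Z y s v). exact E. }
  assert (Zt : forall x t u, xi x t 0 <> 0 -> dt (du (du phi)) x t u = 0).
  { intros y s v K. vanish E (fun s => xi y s 0) s (fun s => Z y s v). exact E. }
  assert (Zxx : forall x t u, xi x t 0 <> 0 -> dx (dx (du (du phi))) x t u = 0).
  { intros y s v K. vanish E (fun y => xi y s 0) y (fun y => Zx y s v). exact E. }
  assert (Zxt : forall x t u, xi x t 0 <> 0 -> dx (dt (du (du phi))) x t u = 0).
  { intros y s v K. vanish E (fun y => xi y s 0) y (fun y => Zt y s v). exact E. }
  assert (Zxxt : forall x t u, xi x t 0 <> 0 -> dx (dx (dt (du (du phi)))) x t u = 0).
  { intros y s v K. vanish E (fun y => xi y s 0) y (fun y => Zxt y s v). exact E. }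
  assert (Zu : du (du (du phi)) x t u = 0).
  { unfold du at 1. rewrite (Derive_ext _ (fun _ => 0)); [apply Derive_const|].
    intros; now apply duu_phi_0. }
  assert (A1 := affine_u phi x t Hphi (fun u => Z x t u H) u).
  assert (A2 := affine_u (dx phi) x t ltac:(smooth)).
  assert (A3 := affine_u (dx (dx phi)) x t ltac:(smooth)).
  assert (A4 := affine_u (dt phi) x t ltac:(smooth)).
  assert (A5 := affine_u (dx (dx (dt phi))) x t ltac:(smooth)).
  assert (A6 := affine_u (dx (dt phi)) x t ltac:(smooth)).
  commute A2. commute A3. commute A4. commute A5. commute A6.
  specialize (A2 (fun u => Zx x t u H) u).
  specialize (A3 (fun u => Zxx x t u H) u).
  specialize (A4 (fun u => Zt x t u H) u).
  specialize (A5 (fun u => Zxxt x t u H) u).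
  specialize (A6 (fun u => Zxt x t u H) u).
  destruct A1 as [A1 B1], A2 as [A2 B2], A3 as [A3 B3], A4 as [A4 B4], A5 as [A5 B5],
   A6 as [A6 B6].
  cbv zeta in *. unfold Ex, Exx in *.
  rewrite !du_dt in S by smooth.
  rewrite A1, A2, A3, A4, A5, B1, B2, B3, B4, B6, Z, Zx, Zt, Zu in S by exact H.
  etransitivity; [|exact S]. ring.
Qed.

(* [xi] is independent of [u] and, where [xi <> 0], [phi = a * u + b]; all the
   functions below are evaluated at [u = 0]. *)
Local Notation X x t := (xi x t 0).
Local Notation Xx x t := (dx xi x t 0).
Local Notation Xxx x t := (dx (dx xi) x t 0).
Local Notation Xxxx x t := (dx (dx (dx xi)) x t 0).
Local Notation Xt x t := (dt xi x t 0).
Local Notation Xxt x t := (dx (dt xi) x t 0).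
Local Notation Xxxt x t := (dx (dx (dt xi)) x t 0).
Local Notation a x t := (du phi x t 0).
Local Notation at' x t := (dt (du phi) x t 0).
Local Notation b x t := (phi x t 0).
Local Notation bx x t := (dx phi x t 0).
Local Notation bt x t := (dt phi x t 0).
Local Notation bxx x t := (dx (dx phi) x t 0).
Local Notation bxxt x t := (dx (dx (dt phi)) x t 0).

(** At p = q = 0 the coefficient of u^2 is X a_x. *)
Lemma ax_0 x t : X x t <> 0 -> dx (du phi) x t 0 = 0.
Proof.
  intros H.
  assert (P1 := symmetry_condition_affine x t 1 H 0 0). assert (P2 := symmetry_condition_affine x t (-1) H 0 0).
  assert (P3 := symmetry_condition_affine x t 0 H 0 0). cbv zeta in *.
  apply (Rmult_eq_reg_l (X x t)); [lra | exact H].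
Qed.

(** This is the coefficient of up, up to sign. *)
Lemma Xt_eq x t : X x t <> 0 -> Xt x t - X x t * (a x t + Xx x t) = 0.
Proof.
  intros H.
  assert (P1 := symmetry_condition_affine x t 1 H 1 0). assert (P2 := symmetry_condition_affine x t (-1) H 1 0).
  assert (P3 := symmetry_condition_affine x t 1 H (-1) 0). assert (P4 := symmetry_condition_affine x t (-1) H (-1) 0).
  cbv zeta in *. lra.
Qed.

Lemma symmetry_condition_affine_x x t u : X x t <> 0 -> forall p q,
  let f := b x t + u * a x t in
  let w := f - X x t * p in
  let wx := bx x t + p * a x t - Xx x t * p - X x t * q in
  let wxx := w + (1 + u) * p in
  X x t * (
    f * p + (1 + u) * (X x t * q + wx)
    + (bt x t + u * at' x t + w * a x t - Xt x t * p)
    - (bxxt x t + q * at' x t + wxx * a x t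
       - Xxxt x t * p - 2 * Xxt x t * q - Xxx x t * wx - 2 * Xx x t * wxx))
  + Xt x t * (bxx x t + q * a x t - Xxx x t * p - 2 * Xx x t * q - wxx) = 0.
Proof.
  intros H p q.
  assert (S := symmetry_condition_affine x t u H p q).
  vanish axx (fun y => xi y t 0) x (fun y => ax_0 y t).
  vanish axt (fun s => xi x s 0) t (ax_0 x).
  rewrite dt_dx in axt by smooth.
  assert (axt' : forall x t, X x t <> 0 -> dx (dt (du phi)) x t 0 = 0).
  { intros y s K. vanish E (fun s => xi y s 0) s (ax_0 y).
    rewrite dt_dx in E by smooth. exact E. }
  vanish axxt (fun y => xi y t 0) x (fun y => axt' y t).
  cbv zeta in *. rewrite axx, axt, axxt, (ax_0 x t H) in S.
  etransitivity; [|exact S]. ring.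
Qed.

Lemma Xxt_eq x t : X x t <> 0 ->
  Xxt x t - (Xx x t * (a x t + Xx x t) + X x t * Xxx x t) = 0.
Proof.
  intros H. vanish E (fun y => xi y t 0) x (fun y => Xt_eq y t).
  rewrite (ax_0 x t H) in E. lra.
Qed.

Lemma Xxxt_eq x t : X x t <> 0 -> Xxxt x t =
  Xxx x t * a x t + 3 * Xx x t * Xxx x t + X x t * Xxxx x t.
Proof.
  intros H. vanish E (fun y => xi y t 0) x (fun y => Xxt_eq y t).
  rewrite (ax_0 x t H) in E. lra.
Qed.

(** From the coefficient of q at u = p = 0, after eliminating X_t and X_xt. *)
Lemma at_eq x t : X x t <> 0 ->
  a x t * a x t + a x t * Xx x t - at' x t + X x t * Xxx x t = 0.
Proof.
  intros H.
  assert (P1 := symmetry_condition_affine_x x t 0 H 0 1). assert (P2 := symmetry_condition_affine_x x t 0 H 0 (-1)).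
  assert (E1 := Xt_eq x t H). assert (E2 := Xxt_eq x t H).
  apply Rminus_diag_uniq in E1. apply Rminus_diag_uniq in E2.
  cbv zeta in *. rewrite E1, E2 in P1, P2.
  apply (Rmult_eq_reg_l (X x t)); [lra | exact H].
Qed.

(** The x-derivative of [at_eq], where a_x and a_xt vanish. *)
Lemma Xxxx_eq x t : X x t <> 0 ->
  a x t * Xxx x t + Xx x t * Xxx x t + X x t * Xxxx x t = 0.
Proof.
  intros H. vanish E (fun y => xi y t 0) x (fun y => at_eq y t).
  vanish axt (fun s => xi x s 0) t (ax_0 x).
  rewrite dt_dx in axt by smooth.
  rewrite (ax_0 x t H), axt in E. lra.
Qed.

(** From the coefficient of p at u = q = 0; the third x-derivative of X brought in by [Xxxt_eq] is
    removed by [Xxxx_eq]. *)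
Lemma b_eq x t : X x t <> 0 -> b x t - (a x t + 2 * X x t * Xx x t) = 0.
Proof.
  intros H.
  assert (P1 := symmetry_condition_affine_x x t 0 H 1 0). assert (P2 := symmetry_condition_affine_x x t 0 H (-1) 0).
  assert (E1 := Xt_eq x t H). apply Rminus_diag_uniq in E1.
  cbv zeta in *. rewrite E1, (Xxxt_eq x t H) in P1, P2.
  assert (K := Xxxx_eq x t H).
  apply (Rmult_eq_reg_l (X x t)); [|exact H].
  apply (Rmult_eq_compat_l (X x t)) in K. lra.
Qed.

Lemma bx_eq x t : X x t <> 0 ->
  bx x t - 2 * (Xx x t * Xx x t + X x t * Xxx x t) = 0.
Proof.
  intros H. vanish E (fun y => xi y t 0) x (fun y => b_eq y t).
  rewrite (ax_0 x t H) in E. lra.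
Qed.

(** From the coefficient of u at p = q = 0, with X X_xx eliminated by [at_eq]. *)
Lemma quadratic_eq x t : X x t <> 0 ->
  3 * (at' x t - a x t * a x t) - a x t * Xx x t + 2 * (Xx x t * Xx x t) = 0.
Proof.
  intros H.
  assert (P1 := symmetry_condition_affine_x x t 1 H 0 0). assert (P2 := symmetry_condition_affine_x x t (-1) H 0 0).
  assert (E1 := Xt_eq x t H). apply Rminus_diag_uniq in E1.
  assert (E2 := bx_eq x t H). apply Rminus_diag_uniq in E2.
  cbv zeta in *. rewrite E1, E2 in P1, P2.
  assert (K := at_eq x t H). apply (Rmult_eq_compat_l (X x t)) in K.
  apply (Rmult_eq_reg_l (X x t)); [|exact H]. lra.
Qed.

Lemma Xxx_0 x t : X x t <> 0 -> Xxx x t = 0.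
Proof.
  assert (D1 : forall x t, X x t <> 0 -> (4 * Xx x t - a x t) * Xxx x t = 0).
  { intros y s H. vanish E (fun y => xi y s 0) y (fun y => quadratic_eq y s).
    vanish axt (fun s => xi y s 0) s (ax_0 y).
    rewrite dt_dx in axt by smooth.
    rewrite (ax_0 y s H), axt in E. lra. }
  intros H. vanish E (fun y => xi y t 0) x (fun y => D1 y t).
  assert (K := D1 x t H). rewrite (ax_0 x t H) in E.
  (* [E] says 4 X_xx^2 + (4 X_x - a) X_xxx = 0. Multiplied by X_xx, its second term vanishes by
     [D1], leaving the cube. *)
  assert (C : Xxx x t * (Xxx x t * Xxx x t) = 0).
  { apply (Rmult_eq_compat_l (Xxxx x t)) in K. apply (Rmult_eq_compat_l (Xxx x t)) in E. lra. }
  destruct (Rmult_integral _ _ C) as [Z|Z]; [exact Z|].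
  destruct (Rmult_integral _ _ Z); assumption.
Qed.

(** With X_xx = 0, [at_eq] and [quadratic_eq] give X_x (a + X_x) = 0. If X_x <> 0, then a = -X_x, so
    X_t, X_xt, a_t and b_t vanish, and the term free of u, p and q reduces to 4 X^2 X_x^2. *)
Lemma Xx_0 x t : X x t <> 0 -> Xx x t = 0.
Proof.
  intros H.
  assert (P := symmetry_condition_affine_x x t 0 H 0 0).
  assert (E1 := Xt_eq x t H). apply Rminus_diag_uniq in E1.
  assert (E2 := Xxt_eq x t H). apply Rminus_diag_uniq in E2.
  assert (E3 := bx_eq x t H). apply Rminus_diag_uniq in E3.
  assert (E4 := b_eq x t H). apply Rminus_diag_uniq in E4.
  assert (bxx0 : forall x t, X x t <> 0 -> bxx x t = 0).
  { intros y s K. vanish E (fun y => xi y s 0) y (fun y => bx_eq y s).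
    vanish E' (fun y => xi y s 0) y (fun y => Xxx_0 y s).
    rewrite (Xxx_0 y s K), E' in E. lra. }
  vanish bxxt0 (fun s => xi x s 0) t (bxx0 x).
  rewrite (dt_dx (dx phi)), (dt_dx phi) in bxxt0 by smooth.
  vanish bt_eq (fun s => xi x s 0) t (b_eq x).
  rewrite dt_dx in bt_eq by smooth.
  assert (A := at_eq x t H). assert (Q := quadratic_eq x t H).
  cbv zeta in P. rewrite (Xxx_0 x t H) in *.
  destruct (Req_dec (Xx x t) 0) as [Z|Z]; [exact Z|].
  assert (As : a x t = - Xx x t).
  { apply (Rmult_eq_reg_l (Xx x t)); [lra | exact Z]. }
  rewrite bxx0, bxxt0, E3, E4 in P by exact H.
  rewrite E1, E2 in *. rewrite As in *.
  assert (Bt : bt x t = 0) by lra.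
  rewrite Bt in P.
  assert (C : X x t * X x t * (Xx x t * Xx x t) = 0) by lra.
  destruct (Rmult_integral _ _ C) as [C'|C']; destruct (Rmult_integral _ _ C'); tauto.
Qed.

Lemma phi_eq x t u : X x t <> 0 -> phi x t u = a x t * (1 + u).
Proof.
  intros H. assert (E := b_eq x t H). rewrite (Xx_0 x t H) in E.
  destruct (affine_u phi x t Hphi (fun u => duu_phi_0 x t u H) u) as [-> _]. lra.
Qed.

Lemma Xx_0_everywhere x t : Xx x t = 0.
Proof.
  apply (derive_0_of_mult (fun x => X x t) (fun x => Xx x t)).
  - intros y; now apply (is_derive_dx xi).
  - intros y. destruct (Req_dec (X y t) 0) as [Z|H].
    + rewrite Z; ring.
    + rewrite (Xx_0 y t H); ring.
Qed.

Lemma X_nonzero x0 t0 : X x0 t0 <> 0 -> forall x t, X x t <> 0.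
Proof.
  intros H x t.
  assert (C : forall y s, X y s = X x0 s).
  { intros y s; apply (constant_of_derive_0 (fun y => X y s)); intros w.
    eapply is_derive_eq; [diff | apply Xx_0_everywhere]. }
  rewrite C. intros Z.
  (* X_t = a X is known only where X <> 0, but (X^2)_t = 2 a X^2 also holds at zeros of X, so the
     linear equation is applied to the square. *)
  apply (linear_ode_nonzero (fun s => 2 * a x0 s) (fun s => X x0 s * X x0 s) t0) with t.
  - intros s. eapply continuous_of_derive. diff.
  - intros s. eapply is_derive_eq; [diff|].
    destruct (Req_dec (X x0 s) 0) as [Y|Y].
    + rewrite Y; ring.
    + assert (E := Xt_eq x0 s Y). rewrite (Xx_0 x0 s Y) in E.
      apply Rminus_diag_uniq in E. rewrite E; ring.
  - now apply Rmult_integral_contrapositive.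
  - rewrite Z; ring.
Qed.

(** Since X never vanishes, [at_eq] is the Riccati equation a_t = a^2 for all t, so a = 0; then phi
    = a (1 + u) and X_t = a X are 0. *)
Lemma phi_0_of_xi_nonzero x0 t0 : X x0 t0 <> 0 ->
  (forall x t u, phi x t u = 0) /\ forall x t u, xi x t u = X x0 t0.
Proof.
  intros H.
  assert (NZ := X_nonzero x0 t0 H).
  assert (A0 : forall x t, a x t = 0).
  { intros x. apply (global_riccati (fun s => a x s) (fun s => at' x s)).
    - intros s; apply (is_derive_dt (du phi)); smooth.
    - intros s _. assert (E := at_eq x s (NZ x s)).
      rewrite (Xx_0 x s (NZ x s)), (Xxx_0 x s (NZ x s)) in E. lra. }
  split.
  - intros x t u. rewrite phi_eq, A0 by apply NZ. ring.
  - intros x t u.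
    transitivity (X x t); [|transitivity (X x0 t)].
    + apply (constant_of_derive_0 (fun s => xi x t s)). intros s.
      rewrite <- (du_xi_0 xi phi Hxi Hphi Hs x t s). now apply is_derive_du.
    + apply (constant_of_derive_0 (fun y => X y t)); intros y.
      eapply is_derive_eq; [diff | apply Xx_0_everywhere].
    + apply (constant_of_derive_0 (fun s => X x0 s)); intros s.
      eapply is_derive_eq; [diff|].
      assert (E := Xt_eq x0 s (NZ x0 s)). rewrite A0, (Xx_0 x0 s (NZ x0 s)) in E. lra.
Qed.
End NonzeroXi.

(** * Classification and linear spans *)

Lemma symmetry_classification xi phi : smooth xi -> smooth phi ->
  nonclassical_symmetry xi (fun _ _ _ => 1) phi ->
  exists c, forall x t u, xi x t u = c /\ phi x t u = 0.
Proof.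
  intros Hxi Hphi Hs.
  destruct (Classical_Prop.classic (exists x t, xi x t 0 <> 0)) as [[x0 [t0 H]]|N].
  - exists (xi x0 t0 0).
    destruct (phi_0_of_xi_nonzero xi phi Hxi Hphi Hs x0 t0 H) as [P Q]. now split.
  - assert (Z : xi = fun _ _ _ => 0).
    { apply fun3_ext; intros x t u. transitivity (xi x t 0).
      - apply (constant_of_derive_0 (fun s => xi x t s)). intros s.
        rewrite <- (du_xi_0 xi phi Hxi Hphi Hs x t s). now apply is_derive_du.
      - destruct (Req_dec (xi x t 0) 0) as [E|E]; [exact E|].
        exfalso; apply N; now exists x, t. }
    exists 0; intros x t u; split; [now rewrite Z|].
    rewrite Z in Hs; now apply phi_0_of_xi_0.
Qed.

Lemma lin_comb_app l l' z : lin_comb (l ++ l') z = lin_comb l z + lin_comb l' z.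
Proof.
  induction l as [|p l IH]; unfold lin_comb in *; simpl; [ring | rewrite IH; ring].
Qed.

Lemma lin_comb_scal c l z :
  lin_comb (map (fun p => (c * fst p, snd p)) l) z = c * lin_comb l z.
Proof.
  induction l as [|p l IH]; unfold lin_comb in *; simpl; [ring|].
  rewrite IH, Rmult_plus_distr_l, Rmult_assoc; reflexivity.
Qed.

(** This reduces each inclusion of spans to the generators. *)
Lemma in_span_trans (S T : dfun -> Prop) F :
  (forall E, S E -> in_span T E) -> in_span S F -> in_span T F.
Proof.
  intros HST [l [Hl E]]. revert F E.
  induction l as [|[c G] l IH]; intros F E.
  - exists nil; split; [intros p []|exact E].
  - destruct (HST G) as [m [Hm Em]]; [apply (Hl (c, G)); now left|].
    destruct (IH (fun p K => Hl p (or_intror K)) (lin_comb l) (fun _ => eq_refl))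
      as [n [Hn En]].
    exists (map (fun p => (c * fst p, snd p)) m ++ n); split.
    + intros p Hp; apply in_app_or in Hp; destruct Hp as [Hp|Hp]; [|now apply Hn].
      apply in_map_iff in Hp; destruct Hp as [q [<- Hq]]; now apply (Hm q).
    + intros z. rewrite lin_comb_app, lin_comb_scal, <- Em, <- En, E. reflexivity.
Qed.

Lemma translation_expr c : nonclassical_expr (fun z => coord 0 1 z + c * coord 1 0 z).
Proof.
  exists (fun _ _ _ => c), (fun _ _ _ => 0).
  split; [apply smooth_const|]. split; [apply smooth_const|].
  split; [apply constant_symmetry|]. intros z; unfold lift; ring.
Qed.

Theorem mainTheorem1 :
  forall F : dfun,
    in_span nonclassical_expr F <->
    in_span (fun E => E = sigma1 \/ E = sigma2 \/ E = sigma3) F.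
Proof.
  intros F; split; apply in_span_trans.
  - intros E [xi [phi [Hxi [Hphi [Hs HE]]]]].
    destruct (symmetry_classification xi phi Hxi Hphi Hs) as [c Hc].
    exists ((1, sigma3) :: (c, sigma2) :: nil); split.
    + intros p [<-|[<-|[]]]; simpl; tauto.
    + intros z. rewrite HE. unfold lin_comb, lift; simpl.
      destruct (Hc (jx z) (jt z) (jd z 0%nat 0%nat)) as [-> ->].
      unfold sigma2, sigma3. ring.
  - assert (H : forall a b, in_span nonclassical_expr
       (fun z => a * coord 0 1 z + b * coord 1 0 z)).
    { intros a b.
      (* Symmetry expressions have u_t-coefficient 1, so a u_t + b u_x is split as (a - b) u_t + b
         (u_t + u_x); in particular u_x is a difference of two of them. *)
      exists ((a - b, fun z => coord 0 1 z + 0 * coord 1 0 z) ::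
              (b, fun z => coord 0 1 z + 1 * coord 1 0 z) :: nil); split.
      - intros p [<-|[<-|[]]]; apply translation_expr.
      - intros z; unfold lin_comb; simpl; ring. }
    intros E [->|[->| ->]].
    + replace sigma1 with (fun z => 1 * coord 0 1 z + 1 * coord 1 0 z); [apply H|].
      extensionality z; unfold sigma1; ring.
    + replace sigma2 with (fun z => 0 * coord 0 1 z + 1 * coord 1 0 z); [apply H|].
      extensionality z; unfold sigma2; ring.
    + replace sigma3 with (fun z => 1 * coord 0 1 z + 0 * coord 1 0 z); [apply H|].
      extensionality z; unfold sigma3; ring.
Qed.
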